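(* Let $p\ge 2$ be an integer. Colorability mod $p$ is an invariant of pseudoknots. That is, if $P$ and $P'$ are two pseudodiagrams representing the same pseudoknot (i.e. related by a finite sequence of planar isotopies, classical Reidemeister moves and pseudo-Reidemeister moves), then all resolutions of $P$ are $p$-colorable classical knots if and only if all resolutions of $P'$ are $p$-colorable classical knots.
   Context: A pseudodiagram of a knot is a knot diagram in the plane in which, at some of the double points, the over/under information may be missing. Double points with over/under information are called classical crossings; those without it are called precrossings. A resolution of a pseudodiagram is a classical knot diagram obtained by choosing over/under information at every precrossing. A pseudoknot is an equivalence class of pseudodiagrams under planar isotopy and the following local moves: the classical Reidemeister moves R1, R2, R3 (involving classical crossings only), and the pseudo-Reidemeister moves: PR1: introduce or remove a kink (monogon) whose crossing is a precrossing. PR2: when a precrossing and a classical crossing are adjacent in a two-strand twist (i.e. they are the two vertices of a bigon), interchange the order of the two along the twist, the classical crossing keeping its sign as a twist: (precrossing, classical crossing) $\leftrightarrow$ (classical crossing, precrossing). PR3 and PR3$'$: slide a strand from one side of a precrossing to the other, where the strand crosses both strands of the precrossing at classical crossings and passes under both of them (one move) or over both of them (the other move), both before and after the slide. A $p$-coloring of a classical knot diagram is an assignment of elements of $\mathbb{Z}/p\mathbb{Z}$ to the arcs of the diagram such that at each crossing two times the element assigned to the over-arc equals the sum of the elements assigned to the two under-arcs. A classical knot is $p$-colorable (colorable mod $p$) if its diagrams have a non-trivial (non-constant) $p$-coloring; this does not depend on the diagram. A pseudodiagram, or the pseudoknot it represents, is called $p$-colorable (colorable mod $p$) if all of its resolutions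 are $p$-colorable. *)

(* Defs.v *)
From HB Require Import structures.
From mathcomp Require Import all_boot all_order all_algebra.
From mathcomp Require Import all_classical all_reals all_analysis.
From Stdlib Require Import Relation_Operators.
Set Implicit Arguments.
Unset Strict Implicit.
Unset Printing Implicit Defensive.
Import Order.TTheory GRing.Theory Num.Theory.
Import numFieldNormedType.Exports.
Local Open Scope classical_set_scope.
Local Open Scope ring_scope.

Definition plane (R : realType) := (R * R)%type.

Definition homeomorphism (T : topologicalType) (h : T -> T) : Prop :=
  exists g : T -> T,
    [/\ continuous h, continuous g, cancel h g & cancel g h].

(* A knot diagram is parametrized by R/Z, i.e. by a 1-periodic curve on R. *)
Definition same_param (R : realType) (s t : R) : Prop := (s - t) \is a Num.int.

(* How a strand passes through a given parameter: [Simple] away from the double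
   points, [Pre] at a precrossing. *)
Inductive passage : Set := Simple | Over | Under | Pre.

Definition opp_passage (x : passage) : passage :=
  match x with Over => Under | Under => Over | _ => x end.

(* Knot diagrams are taken in the topological category: at a double point the
   two strands cross transversally, i.e. look, after a homeomorphism of the
   plane, like the two coordinate axes. *)
Record pseudodiagram (R : realType) := Pseudodiagram {
  curve : R -> plane R;
  pass : R -> passage;
  curve_continuous : continuous curve;
  curve_periodic : forall t, curve (t + 1) = curve t;
  pass_periodic : forall t, pass (t + 1) = pass t;
  no_triple_point : forall r s t, curve r = curve s -> curve s = curve t ->
    [\/ same_param r s, same_param s t | same_param r t];
  transversality : forall s t, ~ same_param s t -> curve s = curve t ->
    exists h : plane R -> plane R, homeomorphism h /\
      exists2 e : R, 0 < e & forall u, `|u| < e ->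
        h (curve (s + u)) = (u, 0) /\ h (curve (t + u)) = (0, u);
  finitely_many_double_points :
    finite_set [set t : R | 0 <= t < 1 /\ pass t <> Simple];
  pass_double_point : forall t,
    pass t <> Simple <-> exists2 s, ~ same_param s t & curve s = curve t;
  pass_consistent : forall s t, ~ same_param s t -> curve s = curve t ->
    pass t = opp_passage (pass s)
}.

Definition classical_diagram (R : realType) (D : pseudodiagram R) : Prop :=
  forall t, pass D t <> Pre.

Definition resolution (R : realType) (P D : pseudodiagram R) : Prop :=
  [/\ classical_diagram D,
      forall t, curve D t = curve P t &
      forall t, pass P t <> Pre -> pass D t = pass P t].

(* A coloring of the arcs is encoded by a function on parameters that is
   constant along each arc, an arc being a stretch of the curve between
   consecutive underpasses. Its values at the underpasses themselves belong to
   no arc and are irrelevant. *)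
Definition is_coloring (R : realType) (p : nat) (D : pseudodiagram R)
    (c : R -> 'Z_p) : Prop :=
  [/\ forall t, c (t + 1) = c t,
      forall s t, s <= t -> (forall r, s <= r <= t -> pass D r <> Under) ->
        c s = c t &
      forall o u s t, pass D o = Over -> pass D u = Under ->
        curve D o = curve D u -> s < u < t ->
        (forall r, s <= r <= t -> r != u -> pass D r <> Under) ->
        c o *+ 2 = c s + c t].

Definition nontrivial_coloring (R : realType) (p : nat) (D : pseudodiagram R)
    (c : R -> 'Z_p) : Prop :=
  exists s t, [/\ pass D s <> Under, pass D t <> Under & c s <> c t].

Definition diagram_colorable (R : realType) (p : nat) (D : pseudodiagram R)
    : Prop :=
  exists c : R -> 'Z_p, is_coloring D c /\ nontrivial_coloring D c.

Definition colorable (R : realType) (p : nat) (P : pseudodiagram R) : Prop :=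
  forall D, resolution P D -> diagram_colorable p D.

(* Diagrams are unoriented subsets of the plane, hence the reparametrization of
   R/Z by a homeomorphism [f] of degree 1 or -1. *)
Definition planar_isotopic (R : realType) (P P' : pseudodiagram R) : Prop :=
  exists (Phi : R -> plane R -> plane R) (f : R -> R),
    [/\ {within [set z : R * plane R | 0 <= z.1 <= 1],
           continuous (fun z => Phi z.1 z.2)},
        forall t, 0 <= t <= 1 -> homeomorphism (Phi t),
        forall x, Phi 0 x = x,
        homeomorphism f /\
          exists b : bool, forall t, f (t + 1) = f t + (-1) ^+ b &
        forall t, curve P' t = Phi 1 (curve P (f t)) /\
                  pass P' t = pass P (f t)].

(* The part of a diagram inside a disk, drawn in the square [-1,1]^2: each
   strand is a path [-1,1] -> [-1,1]^2, with the list of its double points. *)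
Record strand (R : realType) := Strand {
  path_of : R -> plane R;
  marks : seq (R * passage)
}.

Fixpoint passage_at (R : realType) (l : seq (R * passage)) (u : R) : passage :=
  if l is (v, x) :: l' then if u == v then x else passage_at l' u else Simple.

Definition in_square (R : realType) (x : plane R) : Prop :=
  `|x.1| <= 1 /\ `|x.2| <= 1.

(* [P'] is obtained from [P] by replacing the tangle [T] by the tangle [T'] in
   the disk [h^-1([-1,1]^2)]. The i-th strand occupies the parameters
   [m i + r i * u], [-1 <= u <= 1]; a negative [r i] means that the curve runs
   through it backwards. *)
Definition local_replacement (R : realType) (n : nat)
    (T T' : n.-tuple (strand R)) (P P' : pseudodiagram R) : Prop :=
  exists (h : plane R -> plane R) (m r : 'I_n -> R),
    let e i u := m i + r i * u in
    [/\ homeomorphism h,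
        forall i j u v, `|u| <= 1 -> `|v| <= 1 ->
          same_param (e i u) (e j v) -> i = j /\ u = v,
        forall i u, `|u| <= 1 ->
          h (curve P (e i u)) = path_of (tnth T i) u /\
          pass P (e i u) = passage_at (marks (tnth T i)) u,
        forall i u, `|u| <= 1 ->
          h (curve P' (e i u)) = path_of (tnth T' i) u /\
          pass P' (e i u) = passage_at (marks (tnth T' i)) u &
        forall t, (forall i u, `|u| <= 1 -> ~ same_param t (e i u)) ->
          [/\ curve P' t = curve P t, pass P' t = pass P t &
              ~ in_square (h (curve P t))]].

Definition graph_strand (R : realType) (f : R -> R) (l : seq (R * passage))
    : strand R :=
  Strand (fun u => (u, f u)) l.

Definition segment (R : realType) : 1.-tuple (strand R) :=
  [tuple graph_strand (fun=> 0) [::]].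

(* The only double point of this path is (0, 3/8), reached at -1/2 and 1/2. *)
Definition kink (R : realType) (x : passage) : 1.-tuple (strand R) :=
  [tuple Strand (fun u : R => (u * (4 * u ^+ 2 - 1) / 3, (1 - u ^+ 2) / 2))
     [:: (- 2^-1, x); (2^-1, opp_passage x)]].

Definition parallel (R : realType) : 2.-tuple (strand R) :=
  [tuple graph_strand (fun=> 0) [::]; graph_strand (fun=> 3 / 4) [::]].

(* The line [y = 0] and a parabola, crossing at [u = -1/2] and [u = 1/2], the
   line passing both times according to [x]. *)
Definition overlap (R : realType) (x : passage) : 2.-tuple (strand R) :=
  [tuple graph_strand (fun=> 0) [:: (- 2^-1, x); (2^-1, x)];
         graph_strand (fun u : R => u ^+ 2 - 4^-1)
           [:: (- 2^-1, opp_passage x); (2^-1, opp_passage x)]].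

(* Two strands crossing at [u = -1/2] and [u = 1/2], where the descending strand
   (the first one at -1/2, the second one at 1/2) passes according to [x],
   resp. [y]. Two classical crossings thus have the same sign as a twist iff
   [x = y]. *)
Definition twist (R : realType) (x y : passage) : 2.-tuple (strand R) :=
  [tuple graph_strand (fun u : R => u ^+ 2 - 4^-1)
           [:: (- 2^-1, x); (2^-1, opp_passage y)];
         graph_strand (fun u : R => 4^-1 - u ^+ 2)
           [:: (- 2^-1, opp_passage x); (2^-1, y)]].

(* Strands [A] (y = u/2) and [B] (y = -u/2) crossing at the origin, and a third
   strand [C] running below, resp. above, the origin. [ab] is the passage of
   [A] at its crossing with [B], etc. *)
Definition triangle_below (R : realType) (ab ac bc : passage)
    : 3.-tuple (strand R) :=
  [tuple graph_strand (fun u : R => u / 2) [:: (0, ab); (- 2^-1, ac)];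
         graph_strand (fun u : R => - u / 2) [:: (0, opp_passage ab); (2^-1, bc)];
         graph_strand (fun u : R => - (1 - u ^+ 2) / 3)
           [:: (- 2^-1, opp_passage ac); (2^-1, opp_passage bc)]].

Definition triangle_above (R : realType) (ab ac bc : passage)
    : 3.-tuple (strand R) :=
  [tuple graph_strand (fun u : R => u / 2) [:: (0, ab); (2^-1, ac)];
         graph_strand (fun u : R => - u / 2)
           [:: (0, opp_passage ab); (- 2^-1, bc)];
         graph_strand (fun u : R => (1 - u ^+ 2) / 3)
           [:: (- 2^-1, opp_passage bc); (2^-1, opp_passage ac)]].

Definition over_or_under (b : bool) : passage := if b then Over else Under.

(* In [R3], [ha], [hb], [hc] are the heights of the three strands. *)
Inductive local_move (R : realType) :
    forall n, n.-tuple (strand R) -> n.-tuple (strand R) -> Prop :=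
| R1 (b : bool) : local_move (segment R) (kink R (over_or_under b))
| R2 (b : bool) : local_move (parallel R) (overlap R (over_or_under b))
| R3 (ha hb hc : nat) : uniq [:: ha; hb; hc] ->
    let ab := over_or_under (hb < ha)%N in
    let ac := over_or_under (hc < ha)%N in
    let bc := over_or_under (hc < hb)%N in
    local_move (triangle_below R ab ac bc) (triangle_above R ab ac bc)
| PR1 : local_move (segment R) (kink R Pre)
| PR2 (b : bool) :
    local_move (twist R Pre (over_or_under b)) (twist R (over_or_under b) Pre)
| PR3 : local_move (triangle_below R Pre Over Over)
                   (triangle_above R Pre Over Over)
| PR3' : local_move (triangle_below R Pre Under Under)
                    (triangle_above R Pre Under Under).

Definition pseudo_step (R : realType) (P P' : pseudodiagram R) : Prop :=
  planar_isotopic P P' \/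
  exists (n : nat) (T T' : n.-tuple (strand R)),
    local_move T T' /\ local_replacement T T' P P'.

Definition same_pseudoknot (R : realType) (P P' : pseudodiagram R) : Prop :=
  clos_refl_sym_trans (pseudodiagram R) (@pseudo_step R) P P'.

(* Main.v *)
(* A coloring can be checked locally: it is constant near every parameter that
   is not an underpass, and 2c(o) = a + b at a crossing whose underpass u lies
   between stretches colored a and b. Hence colorings can be cut and pasted along
   the boundary of the disk of a move. All the tangles of the moves have their
   crossings at the parameters -1/2, 0, 1/2, so a coloring of a tangle amounts to
   four colors per strand; it is determined by the initial colors of the strands,
   which may be arbitrary, and for the two sides of a move the same initial colors
   produce the same final colors. So a coloring of one diagram is turned into a
   coloring of the other one by recoloring the disk, and constant colorings
   correspond to constant colorings.

   A precrossing of a move is resolved in the same way on both sides, which reduces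
   PR1 and PR3 to R1 and R3; PR2 becomes the exchange of two crossings of a twist,
   which either are equal or cancel each other. *)
Require Import Defs.
From mathcomp Require Import all_boot all_order all_algebra.
From mathcomp Require Import all_classical all_reals all_analysis.
From mathcomp Require Import ring lra zify.
Set Implicit Arguments.
Unset Strict Implicit.
Unset Printing Implicit Defensive.
Import Order.TTheory GRing.Theory Num.Theory.
Import numFieldNormedType.Exports.
Local Open Scope classical_set_scope.
Local Open Scope ring_scope.

(** * Parameters modulo 1, double points and resolutions *)

Section Diagrams.
Variable R : realType.
Implicit Types (r s t : R) (P D : pseudodiagram R).

Lemma same_param_refl t : same_param t t.
Proof. by rewrite /same_param subrr int_num0. Qed.

Lemma same_param_sym s t : same_param s t -> same_param t s.
Proof. by rewrite /same_param -rpredN opprB. Qed.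

Lemma same_param_trans s r t :
  same_param r s -> same_param s t -> same_param r t.
Proof.
by rewrite /same_param => rs st; have := rpredD rs st; rewrite addrA subrK.
Qed.

Lemma same_param_near s t : same_param s t -> `|s - t| < 1 -> s = t.
Proof.
move=> /intrP[k ek]; rewrite ek -intr_norm -[1]/(1%:~R) ltr_int.
by case: k ek => [[|n]|n] //= /eqP; rewrite subr_eq0 => /eqP.
Qed.

Lemma periodic_same_param (T : Type) (f : R -> T) s t :
  (forall u, f (u + 1) = f u) -> same_param s t -> f s = f t.
Proof.
move=> f1 /intrP[k /eqP]; rewrite subr_eq => /eqP ->.
have fn (n : nat) u : f (u + n%:R) = f u.
  by elim: n => [|n IHn]; rewrite ?addr0// -natr1 addrA f1.
case: k => n; first by rewrite addrC -pmulrn fn.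
by rewrite NegzE mulrNz -pmulrn addrC -[LHS](fn n.+1) subrK.
Qed.

(** Removing the linear part (-1)^b u from [f] leaves a 1-periodic function, so [f s] and [f t]
    differ by (-1)^b (s - t). *)
Lemma affine_periodic (f : R -> R) (b : bool) s t :
  (forall u, f (u + 1) = f u + (-1) ^+ b) ->
  same_param s t -> same_param (f s) (f t).
Proof.
move=> f1 st.
have: f s - (-1) ^+ b * s = f t - (-1) ^+ b * t.
  apply: (periodic_same_param (f := fun u => f u - (-1) ^+ b * u)) st => u.
  by rewrite f1; ring.
move=> /eqP; rewrite subr_eq => /eqP efs.
rewrite /same_param efs.
have -> : f t - (-1) ^+ b * t + (-1) ^+ b * s - f t = (-1) ^+ b * (s - t) by ring.
by apply: rpredM => //; rewrite rpredX// rpredN rpred1.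
Qed.

Lemma curve_same_param P s t : same_param s t -> curve P s = curve P t.
Proof. exact/periodic_same_param/curve_periodic. Qed.

Lemma pass_same_param P s t : same_param s t -> pass P s = pass P t.
Proof. exact/periodic_same_param/pass_periodic. Qed.

Lemma opp_passageK : involutive opp_passage. Proof. by case. Qed.

Lemma punctured_same_param t x : exists2 e : R,
  0 < e & forall s, 0 < `|s - t| < e -> ~ same_param s x.
Proof.
pose f := t - x - (Num.floor (t - x))%:~R.
have [f0 f1] : 0 <= f /\ f < 1.
  by rewrite /f; have := floor_itv (t - x); rewrite intrD => /andP[]; lra.
(* [e] is the distance from [t] to the nearest point of x + Z other than [t] itself; [f == 0] means
   that [t] lies in x + Z. *)
pose e := if f == 0 then 1 else Num.min f (1 - f).
exists e.
  rewrite /e; case: ifPn => [_|fN0]; first exact: ltr01.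
  by rewrite lt_min [0 < f]lt_def fN0 f0 subr_gt0.
move=> s /andP[s0 se] sx.
have : same_param (s - t + f) 0.
  rewrite /same_param subr0 /f.
  have -> : s - t + (t - x - (Num.floor (t - x))%:~R) =
            s - x - (Num.floor (t - x))%:~R by ring.
  by rewrite rpredB// intr_int.
move: se; rewrite /e; case: eqP => fE.
  rewrite fE addr0 => s1 /same_param_near; rewrite subr0 => /(_ s1) st.
  by move: s0; rewrite st normr0 ltxx.
rewrite lt_min => /andP[sf s1f] /same_param_near.
have sf' : `|s - t + f - 0| < 1.
  by rewrite subr0 ltr_norml; move: sf s1f; rewrite !ltr_norml; lra.
move=> /(_ sf') sE; move: sf; rewrite ltr_norml => /andP[]; lra.
Qed.

Lemma punctured_same_param_seq t (l : seq R) : exists2 e : R,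
  0 < e & forall s x, 0 < `|s - t| < e -> x \in l -> ~ same_param s x.
Proof.
elim: l => [|y l [e e0 He]]; first by exists 1.
have [e' e'0 He'] := punctured_same_param t y.
exists (Num.min e e'); first by rewrite lt_min e0.
move=> s x; rewrite lt_min => /andP[s0 /andP[se se']].
rewrite in_cons => /predU1P[->|xl]; first by apply: He'; rewrite s0.
by apply: He xl; rewrite s0.
Qed.

Lemma double_points_isolated P t : exists2 e : R,
  0 < e & forall s, 0 < `|s - t| < e -> pass P s = Simple.
Proof.
have /finite_seqP[l lE] := finitely_many_double_points P.
have [e e0 He] := punctured_same_param_seq t l.
exists e => // s /He sl; apply: contrapT => s'.
(* Finiteness is given on [0, 1) only, so [s] is first moved there by an integer. *)
pose s0 := s - (Num.floor s)%:~R.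
have ss0 : same_param s s0.
  by rewrite /same_param /s0 opprB addrC subrK intr_int.
apply: (sl s0 _ ss0).
have : [set` l] s0; last by [].
rewrite -lE /=; split.
  by have := floor_itv s; rewrite intrD /s0 => /andP[]; lra.
by rewrite -(pass_same_param _ ss0).
Qed.

(** By [pass_double_point] the simple parameters are determined by the curve alone, and a resolution
    keeps the curve. *)
Lemma resolution_simple P D t :
  resolution P D -> pass D t = Simple <-> pass P t = Simple.
Proof.
move=> [_ cE _].
have PD : pass D t <> Simple <-> pass P t <> Simple.
  by rewrite !pass_double_point; split=> -[s st]; [rewrite !cE|rewrite -!cE];
    exists s.
by split=> e; apply: contrapT => /PD; rewrite e.
Qed.

(** Resolutions are built by prescribing passages: the geometric fields are those of [P], and only
    the fields about [pass] have to be checked. *)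
Lemma exists_resolution P (q : R -> passage) :
  (forall t, q (t + 1) = q t) ->
  (forall t, q t = Simple <-> pass P t = Simple) ->
  (forall s t, ~ same_param s t -> curve P s = curve P t ->
     q t = opp_passage (q s)) ->
  (forall t, q t <> Pre) ->
  (forall t, pass P t <> Pre -> q t = pass P t) ->
  exists2 D, resolution P D & pass D = q.
Proof.
move=> q1 qS qop qPre qP.
have qfin : finite_set [set t : R | 0 <= t < 1 /\ q t <> Simple].
  apply: sub_finite_set (finitely_many_double_points P) => t /= [t01 qt].
  by split=> // /qS.
have qdp t : q t <> Simple <-> exists2 s, ~ same_param s t & curve P s = curve P t.
  by rewrite -pass_double_point; split=> + /qS.
by exists (Pseudodiagram (@curve_continuous _ P) (@curve_periodic _ P) q1
  (@no_triple_point _ P) (@transversality _ P) qfin qdp qop).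
Qed.

End Diagrams.

(** * Colorings in local form *)

Section Colorings.
Variables (R : realType) (p : nat).
Implicit Types (r s t : R) (D : pseudodiagram R) (c : R -> 'Z_p).

(** Connectedness of [s, t]: the set of points with the color of [s] is nonempty, and both open and
    closed in the segment. *)
Lemma locally_constant_segment (T : Type) (c : R -> T) s t : s <= t ->
  (forall r, s <= r <= t -> exists2 e : R,
     0 < e & forall r', `|r' - r| < e -> c r' = c r) ->
  c s = c t.
Proof.
move=> st clc.
pose B := [set r | s <= r <= t /\ c r = c s].
have opc (A : set T) : open (interior [set r | A (c r)]) by exact: open_interior.
have near r : `[s, t]%classic r -> \forall r' \near r, c r' = c r.
  rewrite /= in_itv /= => /clc[e e0 He]; near=> r'; apply: He.
  by rewrite distrC; near: r'; exact: cvgr_dist_lt.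
suff: B = `[s, t]%classic.
  move/seteqP => [_ /(_ t)]; rewrite /= in_itv /= st lexx => /(_ isT)[_ ->] //.
apply: segment_connected.
- by exists s; rewrite /B /= lexx.
- exists (interior [set r | c r = c s]); first exact: opc (fun x => x = c s).
  apply/seteqP; split => r; rewrite /B /setI /= in_itv /=.
    move=> [str crs]; split => //; rewrite /interior /=.
    by have := near r; rewrite /= in_itv /= crs; exact.
  by move=> [? /nbhs_singleton].
- exists (~` interior [set r | c r <> c s]).
    by apply: open_closedC; exact: opc (fun x => x <> c s).
  apply/seteqP; split => r; rewrite /B /setI /= in_itv /=.
    by move=> [str crs]; split => // /nbhs_singleton.
  move=> [str ncr]; split => //; apply: contrapT => crs; apply: ncr.
  have := near r; rewrite /= in_itv /= => /(_ str); rewrite /interior /=.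
  by apply: filterS => r' /= ->.
Unshelve. all: by end_near. Qed.

(** Every clause but periodicity looks only at neighborhoods of parameters, so that functions can be
    glued. In the last one [a] and [b] are the colors just before and just after the underpass. *)
Definition local_coloring D c :=
  [/\ forall t, c (t + 1) = c t,
      forall t, pass D t <> Under -> exists2 e : R,
        0 < e & forall s, `|s - t| < e -> c s = c t &
      forall o u, pass D o = Over -> pass D u = Under -> curve D o = curve D u ->
        exists (e : R) a b, [/\ 0 < e,
          forall v, 0 < v < e -> c (u - v) = a /\ c (u + v) = b &
          c o *+ 2 = a + b]].

(** Local constancy spreads along segments by connectedness; conversely, double points are isolated,
    so each parameter has a neighborhood without any other underpass. *)
Lemma local_coloringP D c : local_coloring D c <-> is_coloring D c.
Proof.
split=> [[c1 c2 c3]|[c1 c2 c3]]; split=> //.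
- move=> s t st su; apply: locally_constant_segment => // r /su; exact: c2.
- move=> o u s t o_ u_ ou /andP[su ut] H.
  have [e [a [b [e0 ab ->]]]] := c3 _ _ o_ u_ ou.
  (* With this [v] the points u - v and u + v are within [e] of [u] and inside [s, t], so they link
     [a] to [c s] and [b] to [c t]. *)
  pose v := Num.min (Num.min (e / 2) ((u - s) / 2)) ((t - u) / 2).
  have v0 : 0 < v by rewrite !lt_min !divr_gt0 ?subr_gt0.
  have [[v1 v2] v3] : (v <= e / 2 /\ v <= (u - s) / 2) /\ v <= (t - u) / 2.
    by rewrite /v !ge_min !lexx ?orbT.
  have [|<- <-] := ab v; first by apply/andP; split; lra.
  congr (_ + _); [apply/esym|]; (apply: locally_constant_segment; first by lra).
    by move=> r /andP[r1 r2]; apply: c2; apply: H; [|rewrite neq_lt]; lra.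
  by move=> r /andP[r1 r2]; apply: c2; apply: H; [|rewrite neq_lt]; lra.
- move=> t t_; have [e e0 He] := double_points_isolated D t.
  have HU r : `|r - t| < e -> pass D r <> Under.
    have [->//|rt] := eqVneq r t; move=> rte.
    by rewrite He// rte andbT normr_gt0 subr_eq0.
  exists e => // s; rewrite ltr_norml => /andP[s1 s2].
  have [st|/ltW st] := leP s t; last apply/esym.
    by apply: c2 => // r /andP[r1 r2]; apply: HU; rewrite ltr_norml; lra.
  by apply: c2 => // r /andP[r1 r2]; apply: HU; rewrite ltr_norml; lra.
- move=> o u o_ u_ ou; have [e e0 He] := double_points_isolated D u.
  have HU r : `|r - u| < e -> r != u -> pass D r <> Under.
    by move=> rte ru; rewrite He// rte andbT normr_gt0 subr_eq0.
  exists e, (c (u - e / 2)), (c (u + e / 2)); split => //.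
    move=> v /andP[v0 ve]; split.
      have [vh|/ltW vh] := leP v (e / 2); first apply/esym.
        by apply: c2; first lra; move=> r /andP[r1 r2]; apply: HU;
          [rewrite ltr_norml|rewrite neq_lt]; lra.
      by apply: c2; first lra; move=> r /andP[r1 r2]; apply: HU;
          [rewrite ltr_norml|rewrite neq_lt]; lra.
    have [vh|/ltW vh] := leP v (e / 2); last apply/esym.
      by apply: c2; first lra; move=> r /andP[r1 r2]; apply: HU;
        [rewrite ltr_norml|rewrite neq_lt]; lra.
    by apply: c2; first lra; move=> r /andP[r1 r2]; apply: HU;
        [rewrite ltr_norml|rewrite neq_lt]; lra.
  apply: (c3 o u) => //; first by apply/andP; split; lra.
  by move=> r /andP[r1 r2] ru; apply: HU => //; rewrite ltr_norml; lra.
Qed.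

End Colorings.

(** * Invariance under planar isotopy and reparametrization *)

Section Reparametrization.
Variables (R : realType) (p : nat).
Implicit Types P D : pseudodiagram R.

(** What remains of a planar isotopy when only its final homeomorphism is kept; colorings see no
    more than this, and symmetry is immediate. *)
Definition reparametrized P P' := exists (phi : plane R -> plane R) (f : R -> R),
  [/\ homeomorphism phi,
      homeomorphism f /\ exists b : bool, forall t, f (t + 1) = f t + (-1) ^+ b &
      forall t, curve P' t = phi (curve P (f t)) /\ pass P' t = pass P (f t)].

Lemma degree_inverse (f g : R -> R) (b : bool) : cancel f g -> cancel g f ->
  (forall t, f (t + 1) = f t + (-1) ^+ b) -> forall t, g (t + 1) = g t + (-1) ^+ b.
Proof.
move=> fK gK f1 t; apply: (can_inj fK); rewrite gK.
case: b f1 => f1; last by rewrite f1 gK.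
by rewrite -[in LHS](gK t) -[in LHS](subrK 1 (g t)) f1 expr1 subrK.
Qed.

Lemma reparametrized_sym P P' : reparametrized P P' -> reparametrized P' P.
Proof.
move=> [phi [f [[psi [cphi cpsi phiK psiK]] [[g [cf cg fK gK]] [b f1]] H]]].
exists psi, g; split; first by exists phi.
  split; first by exists f.
  by exists b; exact: degree_inverse f1.
by move=> t; have [-> ->] := H (g t); rewrite gK phiK.
Qed.

(** A continuous injection of the line is monotone. Arcs are described by the order of the
    parameters, so both directions have to be handled. *)
Lemma homeomorphism_mono (f : R -> R) : homeomorphism f ->
  {mono f : x y / x <= y} \/ {mono f : x y /~ x <= y}.
Proof.
move=> [g [cf _ fK _]].
have wf : {within [set` `]-oo, +oo[], continuous f} by exact: continuous_subspaceT.
have [H|H] := itv_continuous_inj_mono wf (in2W (can_inj fK)); [left|right].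
  by move=> x y; apply: (le_mono_in H); rewrite in_itv.
by move=> x y; apply: (le_nmono_in H); rewrite in_itv.
Qed.

Lemma reparametrized_colorable_diagram D D' :
  reparametrized D D' -> diagram_colorable p D -> diagram_colorable p D'.
Proof.
move=> [phi [f [[psi [_ _ phiK _]] [hf [b f1]] H]]] [c [[c1 c2 c3] nc]].
have [g [_ _ fK gK]] := hf.
have cE t : curve D' t = phi (curve D (f t)) by have [] := H t.
have pE t : pass D' t = pass D (f t) by have [] := H t.
exists (c \o f); split; last first.
  by have [s [t []]] := nc; exists (g s), (g t); rewrite /= !pE !gK.
split=> [t|s t st su|o u s t].
- apply: (periodic_same_param c1); apply: (affine_periodic f1).
  by rewrite /same_param addrC addKr int_num1.
- have [fm|fm] := homeomorphism_mono hf; [|apply/esym];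
    (apply: c2 => [|r]; first by rewrite fm);
    rewrite -(gK r) !fm -pE => rst; apply: su => //.
  by rewrite andbC.
- rewrite !pE !cE => o_ u_ /(can_inj phiK) ou sut su_.
  (* A decreasing [f] exchanges the two under-arcs of a crossing. *)
  have [fm|fm] := homeomorphism_mono hf; [|rewrite [RHS]addrC];
    (apply: (c3 _ _ _ _ o_ u_ ou) => [|r]).
  + by rewrite !(leW_mono fm).
  + rewrite -(gK r) !fm (can_eq fK) -pE; exact: su_.
  + by rewrite !(leW_nmono fm) andbC.
  + rewrite -(gK r) !fm (can_eq fK) -pE andbC; exact: su_.
Qed.

Lemma reparametrized_colorable P P' :
  reparametrized P P' -> colorable p P -> colorable p P'.
Proof.
move=> PP'; have [psi [g [[phi [cpsi cphi psiK phiK]] [hg [b g1]] H]]] :=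
  reparametrized_sym PP'.
have cE t : curve P t = psi (curve P' (g t)) by have [] := H t.
have pE t : pass P t = pass P' (g t) by have [] := H t.
move=> colP D' D'res; have [D'cl D'c D'p] := D'res.
have [f [_ _ gK fK]] := hg.
have g_same s t : same_param (g s) (g t) <-> same_param s t.
  split; last exact: affine_periodic g1.
  by move=> /(affine_periodic (degree_inverse gK fK g1)); rewrite !gK.
(* The given resolution [D'] of [P'] is pulled back along [g] to a resolution of [P], which is
   colorable by hypothesis and of which [D'] is a reparametrization. *)
have [|t|s t st Pst|t|t|D Dres Dq] := @exists_resolution _ P (pass D' \o g).
- move=> t; apply: pass_same_param; apply: (affine_periodic g1).
  by rewrite /same_param addrC addKr int_num1.
- by rewrite /= pE; exact: resolution_simple.
- apply: pass_consistent; first by rewrite g_same.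
  by rewrite !D'c; apply: (can_inj psiK); rewrite -!cE.
- exact: D'cl.
- by rewrite pE; exact: D'p.
have [_ Dc _] := Dres.
apply: reparametrized_colorable_diagram (colP D Dres).
apply: reparametrized_sym; exists psi, g; split; first by exists phi.
  by split=> //; exists b.
by move=> t; rewrite Dc cE D'c Dq.
Qed.

End Reparametrization.

Lemma planar_isotopic_reparametrized (R : realType) (P P' : pseudodiagram R) :
  planar_isotopic P P' -> reparametrized P P'.
Proof.
move=> [Phi [f [_ hPhi _ hf H]]]; exists (Phi 1), f; split => //.
by apply: hPhi; rewrite ler01 lexx.
Qed.

(** * The four pieces of a strand *)

Section Pieces.
Variable R : realType.
Implicit Types u w : R.

Definition break (k : nat) : R := (k%:R - 1) / 2.

(** Center of the [k]-th quarter of [-1, 1]: a point away from all breaks, at which the color of the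
    piece is read off. *)
Definition midpoint (k : nat) : R := k%:R / 2 - 3 / 4.

(* The breaks -1/2, 0, 1/2 cut a strand into pieces numbered from 0 to 3; each
   piece contains its right end. *)
Definition piece u : nat := ((- 2^-1 < u)%R + (0 < u)%R + (2^-1 < u)%R)%N.

Lemma piece_lt4 u : (piece u < 4)%N.
Proof. by rewrite /piece; do 3![case: (_ < _)%R]. Qed.

Lemma breakE : break 0 = - 2^-1 /\ break 1 = 0 /\ break 2 = 2^-1.
Proof. by rewrite /break; split; [|split]; lra. Qed.

Lemma lt3P (P : nat -> Prop) :
  P 0%N -> P 1%N -> P 2%N -> forall k, (k < 3)%N -> P k.
Proof. by move=> P0 P1 P2 [|[|[|k]]]. Qed.

Lemma lt4P (P : nat -> Prop) :
  P 0%N -> P 1%N -> P 2%N -> P 3%N -> forall k, (k < 4)%N -> P k.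
Proof. by move=> P0 P1 P2 P3 [|[|[|[|k]]]]. Qed.

Lemma midpoint_itv k : (k < 4)%N -> `|midpoint k| <= 1.
Proof. by rewrite /midpoint ler_norml; move: k; apply: lt4P; lra. Qed.

Lemma break_itv k : (k < 3)%N -> `|break k| <= 1.
Proof. by rewrite /break ler_norml; move: k; apply: lt3P; lra. Qed.

(** On the way from [u] to the center of its piece no break is met, except [u] itself when it is the
    right end of the piece. *)
Lemma break_between_piece u k : (k < 3)%N ->
  u <= break k <= midpoint (piece u) \/ midpoint (piece u) <= break k <= u ->
  break k = u.
Proof.
rewrite /piece /midpoint; have [b0 [b1 b2]] := breakE.
move: k; apply: lt3P; rewrite ?b0 ?b1 ?b2;
case: (ltrP (- 2^-1) u) => ?; case: (ltrP 0 u) => ?; case: (ltrP 2^-1 u) => ?;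
by case=> /andP[]; rewrite ?addn0 ?add0n //=; try lra; move=> *; lra.
Qed.

Lemma break_midpoint k w : (k < 3)%N -> midpoint k <= w <= midpoint k.+1 ->
  forall l, (l < 3)%N -> w = break l -> l = k.
Proof.
rewrite /midpoint; have [b0 [b1 b2]] := breakE.
move: k; apply: lt3P => /andP[w1 w2]; apply: lt3P;
by rewrite ?b0 ?b1 ?b2 // => wE; exfalso; lra.
Qed.

Lemma piece_midpoint k : (k < 4)%N -> piece (midpoint k) = k.
Proof.
rewrite /piece; move: k; apply: lt4P; set w := midpoint _;
case: (ltP (- 2^-1) w) => ?; case: (ltP 0 w) => ?; case: (ltP 2^-1 w) => ? //;
by exfalso; move: (erefl w); rewrite {2}/w /midpoint; lra.
Qed.

Lemma piece_break k w : (k < 3)%N -> `|w - break k| < 2^-1 ->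
  piece w = if w <= break k then k else k.+1.
Proof.
rewrite ltr_norml /piece; have [b0 [b1 b2]] := breakE.
move: k; apply: lt3P; rewrite ?b0 ?b1 ?b2 => /andP[w1 w2];
case: (ltP (- 2^-1) w) => ?; case: (ltP 0 w) => ?; case: (ltP 2^-1 w) => ? //;
by exfalso; lra.
Qed.

Lemma lt_near (b u w : R) : u != b -> `|w - u| < `|u - b| -> (b < w) = (b < u).
Proof.
move=> ub; have [bu|ub'] := ltP b u.
  by rewrite [`|u - b|]gtr0_norm ?subr_gt0// ltr_norml => /andP[w1 w2]; lra.
rewrite [`|u - b|]ler0_norm ?subr_le0// ltr_norml => /andP[w1 w2].
by apply/negbTE; rewrite -leNgt; lra.
Qed.

Lemma piece_near u : (forall k, (k < 3)%N -> u <> break k) ->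
  exists2 e : R, 0 < e & forall w, `|w - u| < e -> piece w = piece u.
Proof.
have [b0 [b1 b2]] := breakE => H.
have := H 0%N isT; have := H 1%N isT; have := H 2%N isT; rewrite b0 b1 b2.
move=> /eqP u2 /eqP u1 /eqP u0.
exists (Num.min `|u - - 2^-1| (Num.min `|u - 0| `|u - 2^-1|)).
  by rewrite !lt_min !normr_gt0 !subr_eq0 u0 u1.
move=> w; rewrite !lt_min => /and3P[w0 w1 w2].
by rewrite /piece (lt_near u0)// (lt_near u1)// (lt_near u2).
Qed.

End Pieces.

(** * Tangles in a disk: positions of strands and replacement of a tangle *)

Section Tangles.
Variables (R : realType) (n : nat).
Implicit Types (T : n.-tuple (strand R)) (i j : 'I_n).

Definition tangle_path T i := path_of (tnth T i).

Definition tangle_pass T i := passage_at (marks (tnth T i)).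

(** The first half separates the tangle from the rest of the curve; the second one makes four colors
    per strand sufficient. *)
Definition standard T :=
  (forall i u, `|u| <= 1 -> in_square (tangle_path T i u)) /\
  (forall i u, tangle_pass T i u <> Simple -> exists2 k, (k < 3)%N & u = break R k).

(* [x i k] is the color of the [k]-th piece of the [i]-th strand. *)
Definition tangle_coloring (K : zmodType) T (x : 'I_n -> nat -> K) :=
  (forall i k, (k < 3)%N -> tangle_pass T i (break R k) <> Under ->
     x i k = x i k.+1) /\
  (forall i j k l, (k < 3)%N -> (l < 3)%N ->
     tangle_pass T i (break R k) = Under -> tangle_pass T j (break R l) = Over ->
     tangle_path T i (break R k) = tangle_path T j (break R l) ->
     x j l *+ 2 = x i k + x i k.+1).

(** Equal colors at both ends allow [x'] to be glued to the old coloring outside the disk; the last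
    clause serves to preserve non-triviality. *)
Definition transfers (K : zmodType) T T' :=
  forall x : 'I_n -> nat -> K, tangle_coloring T x ->
  exists x', [/\ tangle_coloring T' x',
    forall i, x' i 0 = x i 0 /\ x' i 3 = x i 3 &
    forall a, (forall i k, (k < 4)%N -> x' i k = a) ->
              forall i k, (k < 4)%N -> x i k = a].

(** The last clause is meant for a tangle with at most one precrossing: any two distinct passages
    marked [Pre] then belong to the same double point. *)
Definition resolves T Tr :=
  [/\ forall i, tangle_path Tr i = tangle_path T i,
      forall i u, tangle_pass Tr i u <> Pre,
      forall i u, tangle_pass Tr i u = Simple <-> tangle_pass T i u = Simple,
      forall i u, tangle_pass T i u <> Pre -> tangle_pass Tr i u = tangle_pass T i u &
      forall i j u v, tangle_pass T i u = Pre -> tangle_pass T j v = Pre ->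
        (i, u) <> (j, v) -> tangle_pass Tr j v = opp_passage (tangle_pass Tr i u)].

Variables (h : plane R -> plane R) (m r : 'I_n -> R).

Definition place i u := m i + r i * u.

Definition drawn T P := forall i u, `|u| <= 1 ->
  h (curve P (place i u)) = tangle_path T i u /\
  pass P (place i u) = tangle_pass T i u.

Definition outside t := forall i u, `|u| <= 1 -> ~ same_param t (place i u).

Definition equal_outside P P' := forall t, outside t ->
  [/\ curve P' t = curve P t, pass P' t = pass P t & ~ in_square (h (curve P t))].

Lemma equal_outside_sym P P' : equal_outside P P' -> equal_outside P' P.
Proof. by move=> PP' t /PP'[-> -> ?]. Qed.

Hypothesis disjoint_strands : forall i j u v, `|u| <= 1 -> `|v| <= 1 ->
  same_param (place i u) (place j v) -> i = j /\ u = v.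

Lemma rate_neq0 i : r i != 0.
Proof.
apply/eqP => r0; have [|||_ /eqP] := @disjoint_strands i i 0 1.
- by rewrite normr0 ler01.
- by rewrite normr1.
- by rewrite /place r0 !mul0r; exact: same_param_refl.
- by rewrite eq_sym oner_eq0.
Qed.

(** Otherwise the strand would cover a full period: its points -1 and -1 + 1/|r i| lie at parameters
    that differ by 1 or -1. *)
Lemma rate_lt i : 2 * `|r i| < 1.
Proof.
rewrite ltNge; apply/negP => ri.
have r0 : 0 < `|r i| by rewrite normr_gt0 rate_neq0.
have [|||_ E] := @disjoint_strands i i (-1) (-1 + `|r i|^-1).
- by rewrite normrN1.
- have : `|r i|^-1 <= 2 by rewrite invf_ple ?posrE//; lra.
  have : 0 < `|r i|^-1 by rewrite invr_gt0.
  by rewrite ler_norml; lra.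
- rewrite /place /same_param; have -> : m i + r i * -1 - (m i + r i * (-1 + `|r i|^-1)) =
    - (r i / `|r i|) by ring.
  have [ri0|ri0|/eqP] := ltgtP (r i) 0; last by rewrite (negbTE (rate_neq0 i)).
    by rewrite ltr0_norm// invrN mulrN divff ?rate_neq0// opprK int_num1.
  by rewrite gtr0_norm// divff ?rate_neq0// rpredN int_num1.
- by have : 0 < `|r i|^-1; [rewrite invr_gt0|lra].
Qed.

(** A strand is closed in R/Z and does not wrap around: if it passes near [t], then it passes
    through [t], and the displacement along it is linear. *)
Lemma near_strand i t : exists2 e : R, 0 < e & forall s u,
  `|s - t| < e -> `|u| <= 1 -> same_param s (place i u) ->
  exists u0, [/\ `|u0| <= 1, same_param t (place i u0) & s - t = r i * (u - u0)].
Proof.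
have ri := rate_lt i; have ri0 := rate_neq0 i.
set q := `|r i| in ri.
have q0 : 0 < q by rewrite normr_gt0.
(* Position of [t] modulo 1, measured from the end m i - q of the strand, which thus occupies
   [0, 2q] inside [0, 1). *)
pose f := t - m i + q - (Num.floor (t - m i + q))%:~R.
have [f0 f1] : 0 <= f /\ f < 1.
  by rewrite /f; have := floor_itv (t - m i + q); rewrite intrD => /andP[]; lra.
have ru u : `|u| <= 1 -> - q <= r i * u <= q.
  by move=> u1; rewrite -ler_norml normrM ler_piMr.
have key s u : same_param s (place i u) -> same_param (f + (s - t)) (r i * u + q).
  rewrite /same_param /f /place => su.
  set N := Num.floor _.
  have -> : t - m i + q - N%:~R + (s - t) - (r i * u + q) =
    s - (m i + r i * u) - N%:~R by ring.
  by rewrite rpredB// intr_int.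
have [fq|fq] := leP f (2 * q).
  (* Here [t] is on the strand; the radius is the length of the gap that the strand leaves in
     R/Z. *)
  exists (1 - 2 * q); first by rewrite subr_gt0.
  move=> s u; rewrite ltr_norml => /andP[s1 s2] u1 /key.
  move=> /same_param_near; rewrite ltr_norml.
  have /andP[u2 u3] := ru u u1.
  have -> : -1 < f + (s - t) - (r i * u + q) < 1 by apply/andP; split; lra.
  move=> /(_ isT) E.
  exists ((f - q) / r i).
  have rE : r i * ((f - q) / r i) = f - q by rewrite mulrC divfK.
  split.
  - rewrite normrM normfV -/q ler_pdivrMr// mul1r ler_norml; apply/andP; split; lra.
  - rewrite /same_param /place rE /f; set N := Num.floor _.
    have -> : t - (m i + (t - m i + q - N%:~R - q)) = N%:~R by ring.
    exact: intr_int.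
  - rewrite mulrBr rE; lra.
(* Here [t] is in the gap; the radius is its distance to the two ends of the strand. *)
exists (Num.min (f - 2 * q) (1 - f)); first by rewrite lt_min !subr_gt0 fq.
move=> s u; rewrite lt_min !ltr_norml => /andP[/andP[s1 s2] /andP[s3 s4]] u1 /key.
move=> /same_param_near; rewrite ltr_norml.
have /andP[u2 u3] := ru u u1.
have -> : -1 < f + (s - t) - (r i * u + q) < 1 by apply/andP; split; lra.
by move=> /(_ isT) E; exfalso; lra.
Qed.

Lemma near_strands t : exists2 e : R, 0 < e & forall s i u,
  `|s - t| < e -> `|u| <= 1 -> same_param s (place i u) ->
  exists u0, [/\ `|u0| <= 1, same_param t (place i u0) & s - t = r i * (u - u0)].
Proof.
have /choice[e He] : forall i, exists e : R, 0 < e /\ forall s u,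
  `|s - t| < e -> `|u| <= 1 -> same_param s (place i u) ->
  exists u0, [/\ `|u0| <= 1, same_param t (place i u0) & s - t = r i * (u - u0)].
  by move=> i; have [e e0 H] := near_strand i t; exists e.
exists (\big[Num.min/1]_i e i).
  by apply: lt_bigmin => // i _; have [] := He i.
move=> s i u st; have [_ Hi] := He i; apply: Hi.
by apply: lt_le_trans st _; exact: bigmin_le_cond.
Qed.

Definition locate t : option ('I_n * R) :=
  match pselect (exists iu, `|iu.2| <= 1 /\ same_param t (place iu.1 iu.2)) with
  | left H => Some (projT1 (cid H))
  | right _ => None
  end.

Variant locate_spec t : option ('I_n * R) -> Prop :=
| Inside i u of `|u| <= 1 & same_param t (place i u) : locate_spec t (Some (i, u))
| Outside of outside t : locate_spec t None.

Lemma locateP t : locate_spec t (locate t).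
Proof.
rewrite /locate; case: pselect => [H|H].
  by case: (cid H) => -[i u] /= []; left.
by right => i u u1 tu; apply: H; exists (i, u).
Qed.

Lemma locate_inside t i u :
  `|u| <= 1 -> same_param t (place i u) -> locate t = Some (i, u).
Proof.
move=> u1 tu; case: locateP => [j v v1 tv|/(_ i u u1)//].
have [-> ->] // := disjoint_strands v1 u1 (same_param_trans (same_param_sym tv) tu).
Qed.

Lemma locate_outside t : outside t -> locate t = None.
Proof. by move=> ot; case: locateP => // i u u1 /(ot _ _ u1). Qed.

Lemma outside_same_param s t : same_param s t -> outside t -> outside s.
Proof.
move=> st ot i u u1 su; apply: (ot i u u1).
exact: same_param_trans (same_param_sym st) su.
Qed.

Lemma locate_same_param s t : same_param s t -> locate s = locate t.
Proof.
move=> st; case: (locateP t) => [i u u1 tu|ot].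
  exact/locate_inside/(same_param_trans st).
exact/locate_outside/(outside_same_param st).
Qed.

Lemma locate_near_outside t : outside t ->
  exists2 e : R, 0 < e & forall s, `|s - t| < e -> outside s.
Proof.
move=> ot; have [e e0 He] := near_strands t; exists e => // s st i u u1 su.
by have [u0 [/ot tu0 /tu0]] := He _ _ _ st u1 su.
Qed.

(** At an end of the strand, [w] leaves [-1, 1] on one side, and the parameter is then on no strand,
    not even on another one. *)
Lemma locate_near_inside t i u : `|u| <= 1 -> same_param t (place i u) ->
  exists2 e : R, 0 < e & forall s, `|s - t| < e ->
    let w := u + (s - t) / r i in
    locate s = if `|w| <= 1 then Some (i, w) else None.
Proof.
move=> u1 tu; have [e e0 He] := near_strands t; exists e => // s st w.
case: ifPn => [w1|w1].
  apply: locate_inside => //; move: tu; rewrite /same_param /place /w => tu.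
  have -> : s - (m i + r i * (u + (s - t) / r i)) = t - (m i + r i * u).
    by have := rate_neq0 i => ?; field.
  by [].
apply: locate_outside => j v v1 sv; move/negP: w1; apply.
have [u0 [u01 tu0 E]] := He _ _ _ st v1 sv.
have [|ji uE] := @disjoint_strands j i u0 u u01 u1.
  exact: same_param_trans (same_param_sym tu0) tu.
by rewrite /w E ji uE mulrC mulKf ?rate_neq0// addrC subrK.
Qed.

Lemma drawn_at T P t i u : drawn T P -> `|u| <= 1 -> same_param t (place i u) ->
  h (curve P t) = tangle_path T i u /\ pass P t = tangle_pass T i u.
Proof.
move=> dT u1 tu; have [<- <-] := dT i u u1.
by rewrite (curve_same_param _ tu) (pass_same_param _ tu).
Qed.

Lemma insideP t : ~ outside t -> exists i u, `|u| <= 1 /\ same_param t (place i u).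
Proof.
by case: (locateP t) => // i u u1 tu _; exists i, u.
Qed.

(** The tangle stays in the square and the rest of the curve avoids it, so no double point involves
    both. *)
Lemma outside_meets_outside T P P' s t : drawn T P -> standard T ->
  equal_outside P P' -> curve P s = curve P t -> outside t -> outside s.
Proof.
move=> dT [T1 _] PP' st /PP'[_ _ nsq] i u u1 su; apply: nsq.
by rewrite -st (drawn_at dT u1 su).1; exact: T1.
Qed.

(** The passages are those of [Tr] on the strands and those of [D] elsewhere; they are consistent
    since the two passages of a double point are both inside or both outside. *)
Lemma replace_resolution P P' D T Tr : drawn T P' -> standard T ->
  equal_outside P P' -> resolves T Tr -> resolution P D ->
  exists D', [/\ resolution P' D', drawn Tr D' & equal_outside D D'].
Proof.
move=> dT stT PP' [rpath rPre rS rnPre rop] DP; have [Dcl Dc Dp] := DP.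
have P'P := equal_outside_sym PP'.
pose q t := if locate t is Some (i, u) then tangle_pass Tr i u else pass D t.
have [t|t|s t nst st|t|t|D' D'P' D'q] := @exists_resolution _ P' q.
- rewrite /q (@locate_same_param (t + 1) t).
    by case: locate => [[]|]; rewrite // pass_periodic.
  by rewrite /same_param addrC addKr int_num1.
- rewrite /q; case: locateP => [i u u1 tu|/PP'[_ -> _]].
    by rewrite (drawn_at dT u1 tu).2; exact: rS.
  exact: (resolution_simple _ DP).
- rewrite /q; have := outside_meets_outside dT stT P'P st.
  have := outside_meets_outside dT stT P'P (esym st).
  case: locateP => [j v v1 tv|ot]; case: locateP => [i u u1 su|os].
  + move=> _ _; have P't := pass_consistent nst st.
    have := P't; rewrite (drawn_at dT v1 tv).2 (drawn_at dT u1 su).2 => tvu.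
    (* At a precrossing the opposite passages come from [rop]; at any other crossing [Tr] agrees
       with [T], hence with [P']. *)
    have [uPre|unPre] := pselect (tangle_pass T i u = Pre).
      apply: rop => //; first by rewrite tvu uPre.
      move=> [ij uv]; apply: nst; apply: same_param_trans su _.
      by rewrite ij uv; exact: same_param_sym.
    by rewrite !rnPre// tvu; case: tangle_pass unPre.
  + by move=> /(_ os)/(_ _ _ v1 tv).
  + by move=> _ /(_ ot)/(_ _ _ u1 su).
  + move=> _ _; apply: pass_consistent nst _; rewrite !Dc.
    by have [<- _ _] := PP' _ os; have [<- _ _] := PP' _ ot.
- by rewrite /q; case: locate => [[i u]|]; [exact: rPre|exact: Dcl].
- rewrite /q; case: locateP => [i u u1 tu|ot].
    by rewrite (drawn_at dT u1 tu).2; exact: rnPre.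
  by have [_ -> _] := PP' _ ot; exact: Dp.
have [_ D'c _] := D'P'.
exists D'; split=> // [i u u1|t ot].
  rewrite D'c (dT i u u1).1 D'q /q (@locate_inside _ i u)//; last exact: same_param_refl.
  by rewrite rpath.
by have [E1 E2 E3] := PP' t ot; rewrite D'c D'q /q locate_outside// Dc E1.
Qed.

(** * Recoloring the disk of a move *)

Section Recoloring.
Variables (p : nat) (T T' : n.-tuple (strand R)) (D D' : pseudodiagram R).
Variables (c : R -> 'Z_p) (x' : 'I_n -> nat -> 'Z_p).
Hypotheses (hI : injective h) (dT : drawn T D) (dT' : drawn T' D').
Hypotheses (stT : standard T) (stT' : standard T') (DD' : equal_outside D D').
Hypothesis colc : is_coloring D c.

Definition piece_color i k := c (place i (midpoint R k)).

Lemma constant_color i u v : `|u| <= 1 -> `|v| <= 1 ->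
  (forall w, u <= w <= v \/ v <= w <= u -> tangle_pass T i w <> Under) ->
  c (place i u) = c (place i v).
Proof.
have ri := rate_neq0 i; have [_ c2 _] := colc.
wlog uv : u v / place i u <= place i v => [H u1 v1 nU|].
  have [/H|/ltW/H] := leP (place i u) (place i v); first exact.
  by move=> E; apply/esym/E => // w [] ?; apply: nU; [right|left].
move=> u1 v1 nU; apply: c2 => // s.
have -> : s = place i ((s - m i) / r i) by rewrite /place mulrC divfK// addrC subrK.
set w := (s - m i) / r i; move: uv; rewrite /place !lerD2l => uv suv.
have {}suv : u <= w <= v \/ v <= w <= u.
  have [ri0|ri0|/eqP] := ltgtP (r i) 0; last by rewrite (negbTE ri).
    by right; move: suv; rewrite !ler_nM2l// andbC.
  by left; move: suv; rewrite !ler_pM2l.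
have w1 : `|w| <= 1 by move: u1 v1; rewrite !ler_norml; case: suv => /andP[]; lra.
by rewrite (dT i w1).2; exact: nU.
Qed.

Lemma color_piece i u : `|u| <= 1 -> tangle_pass T i u <> Under ->
  c (place i u) = piece_color i (piece u).
Proof.
move=> u1 uU; apply: constant_color => //; first exact/midpoint_itv/piece_lt4.
move=> w uw wU; have [|k k3 wk] := stT.2 i w; first by rewrite wU.
by move: uw wU; rewrite wk => /(break_between_piece k3) ->.
Qed.

(** Between two consecutive midpoints the only possible underpass is the break, so the conditions on
    [c] there are exactly those on the sampled colors. *)
Lemma piece_coloring : tangle_coloring T piece_color.
Proof.
have [_ _ c3] := colc.
have kk1 k : (k < 3)%N -> midpoint R k < midpoint R k.+1.
  by rewrite /midpoint -[k.+1]addn1 natrD; lra.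
split=> [i k k3 kU|i j k l k3 l3 iU jO ij].
  apply: constant_color; try (apply: midpoint_itv); rewrite ?(ltn_trans k3)//.
  move=> w kw wU; have [|l l3 wl] := stT.2 i w; first by rewrite wU.
  have {}kw : midpoint R k <= w <= midpoint R k.+1.
    by case: kw => // /andP[w1 w2]; have := kk1 k k3; lra.
  by apply: kU; rewrite -(break_midpoint k3 kw l3 wl) -wl.
have [cU pU] := dT i (break_itv R k3); have [cO pO] := dT j (break_itv R l3).
have oc : curve D (place j (break R l)) = curve D (place i (break R k)).
  by apply: hI; rewrite cU cO ij.
have <- : c (place j (break R l)) = piece_color j l.
  rewrite color_piece ?break_itv// ?jO//.
  by rewrite (piece_break l3) ?lexx ?subrr ?normr0 ?invr_gt0.
have kbk : midpoint R k < break R k < midpoint R k.+1.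
  by rewrite /midpoint /break -[k.+1]addn1 natrD; lra.
have nU w : midpoint R k <= w <= midpoint R k.+1 -> w != break R k ->
    pass D (place i w) <> Under.
  move=> kw wk.
  have w1 : `|w| <= 1.
    have := midpoint_itv R (ltnW k3); have := @midpoint_itv R k.+1 k3.
    by rewrite !ler_norml; lra.
  rewrite (dT i w1).2 => wU; have [|l' l'3 wl'] := stT.2 i w; first by rewrite wU.
  by move/eqP: wk; rewrite wl' (break_midpoint k3 kw l'3 wl').
have ri := rate_neq0 i.
have placeE s : s = place i ((s - m i) / r i).
  by rewrite /place mulrC divfK// addrC subrK.
have [ri0|ri0|/eqP] := ltgtP (r i) 0; last by rewrite (negbTE ri).
  (* The curve runs backwards through the strand when [r i] is negative, which exchanges the two
     under-arcs. *)
  rewrite addrC; apply: c3 oc _ _; rewrite ?pO ?pU//.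
    by rewrite /place !ltrD2l !ltr_nM2l// andbC.
  move=> s; rewrite (placeE s); set w := (s - m i) / r i.
  rewrite /place !lerD2l !ler_nM2l// andbC => kw wk; apply: nU => //.
  by apply: contraNN wk => /eqP ->.
apply: c3 oc _ _; rewrite ?pO ?pU//.
  by rewrite /place !ltrD2l !ltr_pM2l.
move=> s; rewrite (placeE s); set w := (s - m i) / r i.
rewrite /place !lerD2l !ler_pM2l// => kw wk; apply: nU => //.
by apply: contraNN wk => /eqP ->.
Qed.

Hypothesis colx' : tangle_coloring T' x'.
Hypothesis x'0 : forall i, x' i 0 = piece_color i 0.
Hypothesis x'3 : forall i, x' i 3 = piece_color i 3.

Definition recolor t :=
  if locate t is Some (i, u) then x' i (piece u) else c t.

Lemma piece_gt1 (u : R) : 1 <= u -> piece u = 3.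
Proof. by move=> u1; rewrite /piece !(lt_le_trans _ u1)//; lra. Qed.

Lemma piece_ltN1 (u : R) : u <= -1 -> piece u = 0.
Proof. by move=> u1; rewrite /piece !ltNge !(le_trans u1)//; lra. Qed.

(** The formula stays valid slightly beyond the ends of a strand: [piece] is constant there, and
    [x'0], [x'3] say that the outer color is the color of the extreme piece. *)
Lemma recolor_near t i u : `|u| <= 1 -> same_param t (place i u) ->
  exists2 e : R, 0 < e & forall s, `|s - t| < e ->
    recolor s = x' i (piece (u + (s - t) / r i)).
Proof.
move=> u1 tu; have ri := rate_neq0 i.
have [e e0 He] := locate_near_inside u1 tu.
have [c1 c2 _] := (local_coloringP D c).2 colc.
have [uI|uI] := ltP `|u| 1.
  exists (Num.min e ((1 - `|u|) * `|r i|)).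
    by rewrite lt_min e0 mulr_gt0 ?subr_gt0 ?normr_gt0.
  move=> s; rewrite lt_min => /andP[se su]; rewrite /recolor He//.
  rewrite ifT// (le_trans (ler_normD _ _))// -lerBrDl ltW//.
  by rewrite normrM normfV ltr_pdivrMr ?normr_gt0.
(* An end of a strand is no break, so it is simple and [c] is constant around it. *)
have tS : pass D t = Simple.
  rewrite (drawn_at dT u1 tu).2; apply: contrapT => /stT.2[k k3 uk].
  by move: uI; rewrite uk; apply/negP; rewrite -ltNge /break ltr_norml; move: k k3 {uk}; apply: lt3P; lra.
have [|e' e'0 He'] := c2 t; first by rewrite tS.
exists (Num.min e (Num.min e' `|r i|)).
  by rewrite !lt_min e0 e'0 normr_gt0.
move=> s; rewrite !lt_min => /and3P[se se' sr]; rewrite /recolor He//.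
set w := u + _; case: ifPn => // wI; rewrite He'// (periodic_same_param c1 tu).
rewrite color_piece//; last by rewrite -(drawn_at dT u1 tu).2 tS.
(* Hence [w] has left [-1, 1] through the end [u] and not through the opposite one. *)
have wu : `|w - u| < 1.
  by rewrite /w addrC addKr normrM normfV ltr_pdivrMr ?normr_gt0// mul1r.
move: wu wI uI u1; rewrite -ltNge ltr_norml ltr_normr.
have [u0|u0] := leP 0 u.
  rewrite ger0_norm// => /andP[w1 w2] wI u1 u1'.
  have w1' : 1 <= w by case/orP: wI; lra.
  by rewrite !piece_gt1.
rewrite ltr0_norm// => /andP[w1 w2] wI u1 u1'.
have w1' : w <= -1 by case/orP: wI; lra.
by rewrite !piece_ltN1//; lra.
Qed.

Lemma recolor_inside t i u : `|u| <= 1 -> same_param t (place i u) ->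
  recolor t = x' i (piece u).
Proof. by move=> u1 tu; rewrite /recolor (locate_inside u1 tu). Qed.

Lemma recolor_outside t : outside t -> recolor t = c t.
Proof. by move=> ot; rewrite /recolor (locate_outside ot). Qed.

(** Away from the strands this is the coloring [c] of [D]; on them, [recolor_near] reduces every
    local condition to one on [x'] at a break. *)
Lemma recolor_coloring : is_coloring D' recolor.
Proof.
have [c1 c2 c3] := (local_coloringP D c).2 colc.
have [colx'1 colx'2] := colx'.
apply/local_coloringP; split.
- move=> t; have tt1 : same_param (t + 1) t.
    by rewrite /same_param addrC addKr int_num1.
  by rewrite /recolor (locate_same_param tt1) c1.
- move=> t tU; have [ot|/insideP[i [u [u1 tu]]]] := pselect (outside t).
    have [e e0 He] := locate_near_outside ot.
    have [|e' e'0 He'] := c2 t; first by have [_ <-] := DD' ot.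
    exists (Num.min e e'); first by rewrite lt_min e0.
    move=> s; rewrite lt_min => /andP[/He os /He' cs].
    by rewrite !recolor_outside.
  have [e e0 He] := recolor_near u1 tu; have ri := rate_neq0 i.
  have wE (e' : R) s : `|s - t| < e' * `|r i| -> `|u + (s - t) / r i - u| < e'.
    by move=> sr; rewrite addrC addKr normrM normfV ltr_pdivrMr ?normr_gt0.
  have ttE : recolor t = x' i (piece u) by exact: recolor_inside.
  have [[k [k3 uk]]|nk] := pselect (exists k, (k < 3)%N /\ u = break R k).
    exists (Num.min e (2^-1 * `|r i|)).
      by rewrite lt_min e0 mulr_gt0 ?normr_gt0 ?invr_gt0.
    move=> s; rewrite lt_min ttE => /andP[/He -> /wE]; rewrite uk => sk.
    rewrite !(piece_break k3)// ?subrr ?normr0 ?invr_gt0// lexx.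
    (* Both sides of a break that is no underpass have the same color. *)
    by case: ifP => // _; rewrite (colx'1 i k)// -uk -(drawn_at dT' u1 tu).2.
  have [k k3 uk|e' e'0 He'] := @piece_near _ u; first by apply: nk; exists k.
  exists (Num.min e (e' * `|r i|)).
    by rewrite lt_min e0 mulr_gt0 ?normr_gt0.
  by move=> s; rewrite lt_min ttE => /andP[/He -> /wE/He' ->].
- move=> o t oO tU ot_; have [ot|/insideP[i [u [u1 tu]]]] := pselect (outside t).
    have oo := outside_meets_outside dT' stT' (equal_outside_sym DD') ot_ ot.
    have [Dt Pt _] := DD' ot; have [Do Po _] := DD' oo.
    have [e [a [b [e0 ab cab]]]] := c3 o t (etrans (esym Po) oO) (etrans (esym Pt) tU)
      (etrans (esym Do) (etrans ot_ Dt)).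
    have [e' e'0 He'] := locate_near_outside ot.
    exists (Num.min e e'), a, b; split.
    + by rewrite lt_min e0.
    + move=> v /andP[v0]; rewrite lt_min => /andP[ve ve'].
      have addE (w : R) : t + w - t = w by rewrite addrC addKr.
      have oM := He' (t - v); have oD := He' (t + v).
      rewrite !addE normrN gtr0_norm// in oM oD.
      by rewrite (recolor_outside (oM ve')) (recolor_outside (oD ve')); apply: ab; rewrite v0.
    + by rewrite recolor_outside.
  have [|j [v [v1 ov]]] := @insideP o.
    move=> oo; have := outside_meets_outside dT' stT' (equal_outside_sym DD') (esym ot_) oo.
    by move=> /(_ _ _ u1 tu).
  have [ct pt] := drawn_at dT' u1 tu; have [co po] := drawn_at dT' v1 ov.
  have [|k k3 uk] := stT'.2 i u; first by rewrite -pt tU.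
  have [|l l3 vl] := stT'.2 j v; first by rewrite -po oO.
  have [e e0 He] := recolor_near u1 tu; have ri := rate_neq0 i.
  have cE : recolor o *+ 2 = x' i k + x' i k.+1.
    rewrite (recolor_inside v1 ov) vl (piece_break l3) ?subrr ?normr0 ?invr_gt0//.
    rewrite lexx; apply: colx'2 => //.
    + by rewrite -uk -pt.
    + by rewrite -vl -po.
    + by rewrite -uk -vl -ct -co ot_.
  have e'0 : 0 < Num.min e (2^-1 * `|r i|).
    by rewrite lt_min e0 mulr_gt0 ?normr_gt0 ?invr_gt0.
  have side s : `|s - t| < Num.min e (2^-1 * `|r i|) ->
      recolor s = if (s - t) / r i <= 0 then x' i k else x' i k.+1.
    rewrite lt_min => /andP[/He -> sr]; rewrite uk (piece_break k3).
      by rewrite gerDl; case: ifP.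
    by rewrite addrC addKr normrM normfV ltr_pdivrMr ?normr_gt0.
  have sides v0 : 0 < v0 < Num.min e (2^-1 * `|r i|) ->
      recolor (t - v0) = (if - v0 / r i <= 0 then x' i k else x' i k.+1) /\
      recolor (t + v0) = (if v0 / r i <= 0 then x' i k else x' i k.+1).
    move=> /andP[v00 v0e]; have addE (w : R) : t + w - t = w by rewrite addrC addKr.
    by rewrite !side ?addE ?normrN ?(gtr0_norm v00).
  have [ri0|ri0|/eqP] := ltgtP (r i) 0; last by rewrite (negbTE ri).
    exists (Num.min e (2^-1 * `|r i|)), (x' i k.+1), (x' i k); split=> //.
      move=> v0 v0e; have [-> ->] := sides _ v0e; case/andP: v0e => v00 _.
      have q0 : v0 / r i < 0 by rewrite pmulr_rlt0// invr_lt0.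
      by rewrite mulNr oppr_le0 (ltW q0) leNgt q0.
    by rewrite cE addrC.
  exists (Num.min e (2^-1 * `|r i|)), (x' i k), (x' i k.+1); split=> //.
  move=> v0 v0e; have [-> ->] := sides _ v0e; case/andP: v0e => v00 _.
  have q0 : 0 < v0 / r i by rewrite divr_gt0.
  by rewrite mulNr oppr_le0 (ltW q0) leNgt q0.
Qed.

(** By contraposition: if the new coloring is constant, so is [x'], hence the colors of [c] on the
    pieces, while outside the disk nothing has changed. *)
Lemma recolor_nontrivial :
  (forall a, (forall i k, (k < 4)%N -> x' i k = a) ->
     forall i k, (k < 4)%N -> piece_color i k = a) ->
  nontrivial_coloring D c -> nontrivial_coloring D' recolor.
Proof.
move=> x'const [s [t [sU tU cst]]]; apply: contrapT => triv.
have [c1 _ _] := colc.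
have same z w : pass D' z <> Under -> pass D' w <> Under -> recolor z = recolor w.
  by move=> zU wU; apply: contrapT => zw; apply: triv; exists z, w.
have [a Ha] : exists a, forall z, pass D' z <> Under -> recolor z = a.
  have [[z zU]|nz] := pselect (exists z, pass D' z <> Under).
    by exists (recolor z) => w wU; exact: same.
  (* The color 0 is arbitrary: the condition on it is vacuous in this case. *)
  by exists 0 => z zU; case: nz; exists z.
have midpoint_pass i k : (k < 4)%N -> tangle_pass T' i (midpoint R k) = Simple.
  move=> k4; apply: contrapT => /stT'.2[l l3]; rewrite /midpoint /break.
  by move: k k4; apply: lt4P; move: l l3; apply: lt3P; lra.
have x'a i k : (k < 4)%N -> x' i k = a.
  move=> k4; have mk := midpoint_itv R k4.
  rewrite -(Ha (place i (midpoint R k))); last by rewrite (dT' i mk).2 midpoint_pass.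
  by rewrite (recolor_inside mk (same_param_refl _)) piece_midpoint.
suff Hc z : pass D z <> Under -> c z = a by apply: cst; rewrite !Hc.
move=> zU; have [oz|/insideP[i [u [u1 zu]]]] := pselect (outside z).
  by rewrite -(recolor_outside oz) Ha//; have [_ -> _] := DD' oz.
rewrite (periodic_same_param c1 zu) color_piece//.
  exact: x'const x'a _ _ (piece_lt4 u).
by rewrite -(drawn_at dT u1 zu).2.
Qed.

End Recoloring.

Lemma transfer_colorable (p : nat) T T' D D' : injective h ->
  drawn T D -> drawn T' D' -> standard T -> standard T' -> equal_outside D D' ->
  transfers 'Z_p T T' -> diagram_colorable p D -> diagram_colorable p D'.
Proof.
move=> hI dT dT' stT stT' DD' TT' [c [colc ntc]].
have [x' [colx' x'ends x'const]] := TT' _ (piece_coloring hI dT stT colc).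
exists (recolor c x'); split.
  by apply: (recolor_coloring dT dT') => // i; have [] := x'ends i.
exact: (recolor_nontrivial dT dT' stT stT' DD').
Qed.

End Tangles.

(** * Families of tangles indexed by the resolution of a precrossing *)

Section Families.
Variables (R : realType) (n : nat).
Implicit Types (T : n.-tuple (strand R)) (F : passage -> n.-tuple (strand R)).

(* [F x] is the tangle [F Pre] with its precrossing, if any, replaced by a
   crossing of type [x]. *)
Definition resolving F :=
  (forall b, resolves (F Pre) (F (over_or_under b))) /\
  forall (h : plane R -> plane R) (m r : 'I_n -> R) P D,
    injective h ->
    (forall i j u v, `|u| <= 1 -> `|v| <= 1 ->
       same_param (place m r i u) (place m r j v) -> i = j /\ u = v) ->
    drawn h m r (F Pre) P -> resolution P D ->
    exists b, drawn h m r (F (over_or_under b)) D.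

Lemma classical_resolving T :
  (forall i u, tangle_pass T i u <> Pre) -> resolving (fun=> T).
Proof.
move=> TPre; split=> [b|h m r P D _ _ dT [_ Dc Dp]].
  by split=> // i j u v /TPre.
(* The family is constant, so [true] is an arbitrary choice. *)
exists true => i u u1; have [cE pE] := dT i u u1.
by rewrite Dc Dp ?pE.
Qed.

(** [A] and [B] are the two passages of the precrossing. The passage of a resolution at [A] fixes
    [b], and the one at [B] is then forced to be its opposite. *)
Lemma precrossing_resolving F (A B : 'I_n * R) :
  `|A.2| <= 1 -> `|B.2| <= 1 -> A != B ->
  (forall x i, tangle_path (F x) i = tangle_path (F Pre) i) ->
  tangle_path (F Pre) A.1 A.2 = tangle_path (F Pre) B.1 B.2 ->
  (forall x i u, tangle_pass (F x) i u =
     if (i, u) == A then x else if (i, u) == B then opp_passage x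
     else tangle_pass (F Pre) i u) ->
  (forall i u, tangle_pass (F Pre) i u = Pre -> (i, u) = A \/ (i, u) = B) ->
  resolving F.
Proof.
case: A B => [iA uA] [iB uB] /= A1 B1 AB Fpath pathAB Fpass FPre.
have BA := AB; rewrite eq_sym in BA.
have xPre b : over_or_under b <> Pre by case: b.
split=> [b|h m r P D hI disj dF [Dcl Dc Dp]].
  split=> // [i u|i u|i u nPre|i j u v].
  - rewrite Fpass; case: eqP => // uA'; case: eqP => [_|uB']; first by case: (b).
    by move=> /FPre[].
  - rewrite Fpass [in X in _ <-> X]Fpass.
    by case: eqP => _; [case: (b)|case: eqP => _ //; case: (b)].
  - move: nPre; rewrite Fpass [in X in _ -> X = _]Fpass.
    by do 2?[case: eqP => // _].
  - rewrite (Fpass (over_or_under b) i) (Fpass (over_or_under b) j).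
    move=> /FPre[] -> /FPre[] -> // _; rewrite ?eqxx ?(negbTE BA)//.
    by rewrite opp_passageK.
have [cA _] := dF iA uA A1; have [cB _] := dF iB uB B1.
have nAB : ~ same_param (place m r iA uA) (place m r iB uB).
  by move=> /disj[//|//|E1 E2]; move/eqP: AB; apply; rewrite E1 E2.
have := @pass_consistent _ D _ _ nAB; rewrite !Dc.
move=> /(_ (hI _ _ (etrans cA (etrans pathAB (esym cB))))) DB.
have [b DA] : exists b, pass D (place m r iA uA) = over_or_under b.
  have : pass D (place m r iA uA) <> Simple.
    rewrite (resolution_simple _ (And3 Dcl Dc Dp)) (dF iA uA A1).2.
    by rewrite Fpass eqxx.
  have := Dcl (place m r iA uA).
  by case: pass => // _ _; [exists true|exists false].
exists b => i u u1; rewrite Dc Fpath (dF i u u1).1; split => //.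
rewrite Fpass; case: eqP => [[-> ->] //|nA]; case: eqP => [[-> ->] //|nB].
  by rewrite DB DA.
by rewrite Dp (dF i u u1).2 // => /FPre[].
Qed.

Lemma resolves_standard T Tr : standard T -> resolves T Tr -> standard Tr.
Proof.
move=> [T1 T2] [pathE _ S _ _]; split=> [i u|i u uS].
  by rewrite pathE; exact: T1.
by apply: (T2 i) => /S.
Qed.

Definition equivalent_families (K : zmodType) F F' :=
  [/\ resolving F, resolving F', standard (F Pre), standard (F' Pre) &
      forall b, transfers K (F (over_or_under b)) (F' (over_or_under b))].

(** A resolution [D'] of [P'] shows some member of [F'] in the disk. Putting the member of [F] with
    the same [b] in its place gives a resolution of [P], whose coloring is transferred back to
    [D']. *)
Lemma equivalent_families_colorable (p : nat) F F' P P' :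
  equivalent_families 'Z_p F F' -> local_replacement (F' Pre) (F Pre) P' P ->
  colorable p P -> colorable p P'.
Proof.
move=> [resF resF' stF stF' FF'] [h [m [r [[g [_ _ hK _]] disj dF' dF P'P]]]].
move=> colP D' D'P'.
have [b dD'] := resF'.2 h m r P' D' (can_inj hK) disj dF' D'P'.
have [D [DP dD D'D]] := replace_resolution disj dF stF P'P (resF.1 b) D'P'.
apply: (transfer_colorable disj (can_inj hK) dD dD') (colP D DP).
- exact: resolves_standard stF (resF.1 b).
- exact: resolves_standard stF' (resF'.1 b).
- exact: equal_outside_sym D'D.
- exact: FF'.
Qed.

Lemma local_replacement_sym T T' P P' :
  local_replacement T T' P P' -> local_replacement T' T P' P.
Proof.
move=> [h [m [r [hh disj dT dT' PP']]]]; exists h, m, r; split=> //.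
exact: equal_outside_sym PP'.
Qed.

End Families.

(** * Propagation of colors through a tangle *)

Section Spreading.
Variables (R : realType) (n : nat) (K : comNzRingType).
Implicit Types (T : n.-tuple (strand R)) (x : 'I_n -> nat -> K).
Implicit Types S : ('I_n -> K) -> 'I_n -> nat -> K.

(** [S a] is the unique coloring of the tangle with initial colors [a], so that comparing two
    tangles amounts to comparing final colors. *)
Definition spreads T S :=
  [/\ forall x, tangle_coloring T x ->
        forall i k, (k < 4)%N -> x i k = S (x^~ 0) i k,
      forall a, tangle_coloring T (S a),
      forall a i, S a i 0 = a i &
      forall a i k, (k < 4)%N -> S (fun=> a) i k = a].

Lemma spreads_transfers T T' S S' : spreads T S -> spreads T' S' ->
  (forall a i, S a i 3 = S' a i 3) -> transfers K T T'.
Proof.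
move=> [TS _ _ Sconst] [_ S'T' S'0 _] SS' x colx; exists (S' (x^~ 0)); split=> //.
  by move=> i; split; [rewrite S'0|rewrite -SS' -TS].
move=> a Ha i k k4; rewrite TS//.
have -> : x^~ 0 = fun=> a by apply/funext => j; rewrite -(S'0 (x^~ 0) j) Ha.
exact: Sconst.
Qed.

(* The color, after a crossing with a strand of color [q], of a strand of color
   [c] that passes over if [b]. *)
Definition after_crossing (b : bool) (c q : K) := if b then c else q *+ 2 - c.

Lemma after_crossing_const b c : after_crossing b c c = c.
Proof. by case: b; rewrite /after_crossing//; ring. Qed.

Lemma coloring_simple T x i k : tangle_coloring T x -> (k < 3)%N ->
  tangle_pass T i (break R k) = Simple -> x i k.+1 = x i k.
Proof. by move=> [x1 _] k3 kS; rewrite [RHS]x1// kS. Qed.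

Lemma coloring_crossing T x i j k l b : tangle_coloring T x ->
  (k < 3)%N -> (l < 3)%N ->
  tangle_pass T i (break R k) = over_or_under b ->
  tangle_pass T j (break R l) = over_or_under (~~ b) ->
  tangle_path T i (break R k) = tangle_path T j (break R l) ->
  x i k.+1 = after_crossing b (x i k) (x j l) /\
  x j l.+1 = after_crossing (~~ b) (x j l) (x i k).
Proof.
move=> [x1 x2] k3 l3; case: b => /= ip jp ij; rewrite /after_crossing /=; split.
- by rewrite -x1// ip.
- by rewrite (x2 j i l k)// addrC addKr.
- by rewrite (x2 i j k l)// addrC addKr.
- by rewrite -x1// jp.
Qed.

Lemma break_inj k l : break R k = break R l -> k = l.
Proof.
move=> kl; have /eqP : k%:R = l%:R :> R by move: kl; rewrite /break; lra.
by rewrite eqr_nat => /eqP.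
Qed.

(** Strands that are graphs over the first coordinate can only meet at equal parameters, so
    crossings need one index [k] instead of two. *)
Lemma graph_coloring T x : (forall i u, (tangle_path T i u).1 = u) ->
  (forall i k, (k < 3)%N -> tangle_pass T i (break R k) <> Under ->
     x i k = x i k.+1) ->
  (forall k, (k < 3)%N -> forall i j, tangle_pass T i (break R k) = Under ->
     tangle_pass T j (break R k) = Over -> x j k *+ 2 = x i k + x i k.+1) ->
  tangle_coloring T x.
Proof.
move=> graphT x1 x2; split=> // i j k l k3 l3 iU jO ij.
have kl : k = l by apply: break_inj; rewrite -[LHS](graphT i) ij graphT.
by subst l; exact: x2.
Qed.

End Spreading.

Section BreakValues.
Variable R : realType.

Lemma break0 : break R 0 = - 2^-1. Proof. by have [] := breakE R. Qed.

Lemma break1 : break R 1 = 0. Proof. by have [_ []] := breakE R. Qed.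

Lemma break2 : break R 2 = 2^-1. Proof. by have [_ []] := breakE R. Qed.

Lemma eq_breaks :
  (((- 2^-1 == 0 :> R) = false) * ((- 2^-1 == 2^-1 :> R) = false) *
   ((0 == - 2^-1 :> R) = false) * ((0 == 2^-1 :> R) = false) *
   ((2^-1 == 0 :> R) = false) * ((2^-1 == - 2^-1 :> R) = false))%type.
Proof. by do ?split; apply/negbTE; rewrite neq_lt; lra. Qed.

Lemma opp_over_or_under b : opp_passage (over_or_under b) = over_or_under (~~ b).
Proof. by case: b. Qed.

Lemma over_or_under_neq_Pre b : over_or_under b <> Pre. Proof. by case: b. Qed.

End BreakValues.

Lemma ord2P (P : 'I_2 -> Prop) : P (@Ordinal 2 0 isT) -> P (@Ordinal 2 1 isT) ->
  forall i, P i.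
Proof.
by move=> P0 P1 [[|[|k]] ki] //; rewrite (bool_irrelevance ki isT).
Qed.

Lemma ord3P (P : 'I_3 -> Prop) : P (@Ordinal 3 0 isT) -> P (@Ordinal 3 1 isT) ->
  P (@Ordinal 3 2 isT) -> forall i, P i.
Proof.
by move=> P0 P1 P2 [[|[|[|k]]] ki] //; rewrite (bool_irrelevance ki isT).
Qed.

Ltac eval_tangle :=
  rewrite /tangle_pass /tangle_path /tnth /= ?break0 ?break1 ?break2 ?eqxx
    ?eq_breaks /= ?opp_over_or_under ?negbK.

Ltac solve_crossing := eval_tangle; try reflexivity; congr pair; field.

(** * Colorings of the tangles of the moves *)

Section Moves.
Variables (R : realType) (K : comNzRingType).
Local Notation AC := (@after_crossing K).

Definition spread_constant n (a : 'I_n -> K) (i : 'I_n) (k : nat) := a i.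

Lemma spreads_unmarked n (T : n.-tuple (strand R)) :
  (forall i u, tangle_pass T i u = Simple) -> spreads T (@spread_constant n).
Proof.
move=> TS; split=> // [x colx i k k4|a].
  have H l : (l < 3)%N -> x i l.+1 = x i l.
    by move=> l3; apply: (coloring_simple colx l3).
  by move: k k4; apply: lt4P; rewrite ?H.
by split=> // i j k l _ _; rewrite TS.
Qed.

Lemma spreads_segment : spreads (segment R) (@spread_constant 1).
Proof. by apply: spreads_unmarked => i u; rewrite (ord1 i); eval_tangle. Qed.

Lemma spreads_parallel : spreads (parallel R) (@spread_constant 2).
Proof. by apply: spreads_unmarked => i u; move: i; apply: ord2P; eval_tangle. Qed.

Lemma spreads_kink b : spreads (kink R (over_or_under b)) (@spread_constant 1).
Proof.
split=> // [x colx i|a].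
  rewrite (ord1 i) {i}.
  have [] := @coloring_crossing _ _ _ _ _ ord0 ord0 0 2 b colx isT isT _ _ _.
  - by eval_tangle.
  - by eval_tangle.
  - by solve_crossing.
  have := @coloring_simple _ _ _ _ _ ord0 1 colx isT; eval_tangle => /(_ erefl) x2.
  rewrite /after_crossing /spread_constant.
  case: b colx => /= _ x1 x3; first by apply: lt4P; rewrite ?x3 ?x2 ?x1//; ring.
  (* The crossing relation 2c = c + c' is solved without dividing by 2, which may not be invertible
     in [K]. *)
  have x0 : x ord0 0 = x ord0 1.
    have -> : x ord0 0 = x ord0 2 *+ 2 - x ord0 1 by rewrite x1; ring.
    by rewrite x2; ring.
  by apply: lt4P; rewrite ?x3 ?x2 ?x0.
by split=> // i j k l _ _ _ _ _; rewrite (ord1 i) (ord1 j) /spread_constant; ring.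
Qed.

Definition spread_overlap b (a : 'I_2 -> K) (i : 'I_2) (k : nat) : K :=
  let a0 := a (@Ordinal 2 0 isT) in
  let b0 := a (@Ordinal 2 1 isT) in
  let a1 := AC b a0 b0 in let b1 := AC (~~ b) b0 a0 in
  let a2 := AC b a1 b1 in let b2 := AC (~~ b) b1 a1 in
  nth 0 (nth [::] [:: [:: a0; a1; a1; a2]; [:: b0; b1; b1; b2]] i) k.

Lemma spreads_overlap b : spreads (overlap R (over_or_under b)) (spread_overlap b).
Proof.
split.
- move=> x colx.
  have [||| xA1 xB1] := @coloring_crossing _ _ _ _ _ (@Ordinal 2 0 isT)
    (@Ordinal 2 1 isT) 0 0 b colx isT isT; [by solve_crossing..|].
  have [||| xA3 xB3] := @coloring_crossing _ _ _ _ _ (@Ordinal 2 0 isT)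
    (@Ordinal 2 1 isT) 2 2 b colx isT isT; [by solve_crossing..|].
  have xA2 : x (@Ordinal 2 0 isT) 2 = x (@Ordinal 2 0 isT) 1.
    by apply: (@coloring_simple _ _ _ _ _ _ 1 colx isT); eval_tangle.
  have xB2 : x (@Ordinal 2 1 isT) 2 = x (@Ordinal 2 1 isT) 1.
    by apply: (@coloring_simple _ _ _ _ _ _ 1 colx isT); eval_tangle.
  apply: ord2P; apply: lt4P; rewrite /spread_overlap /=;
  by rewrite ?(xA3, xA2, xA1, xB3, xB2, xB1).
- move=> a; apply: graph_coloring.
  + by apply: ord2P.
  + by apply: ord2P; apply: lt3P; eval_tangle; move: b => [].
  + by apply: lt3P; apply: ord2P; apply: ord2P; eval_tangle;
      move: b => [] //= _ _; rewrite /spread_overlap /=; ring.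
- by move=> a; apply: ord2P.
- by move=> a; apply: ord2P; apply: lt4P; rewrite /spread_overlap /= ?after_crossing_const.
Qed.

(** At the second crossing [b'] describes the second strand, hence the negation for the first one.
    The middle colors are repeated since nothing crosses at 0. *)
Definition spread_twist b b' (a : 'I_2 -> K) (i : 'I_2) (k : nat) : K :=
  let a0 := a (@Ordinal 2 0 isT) in
  let b0 := a (@Ordinal 2 1 isT) in
  let a1 := AC b a0 b0 in let b1 := AC (~~ b) b0 a0 in
  let a2 := AC (~~ b') a1 b1 in let b2 := AC b' b1 a1 in
  nth 0 (nth [::] [:: [:: a0; a1; a1; a2]; [:: b0; b1; b1; b2]] i) k.

Lemma spreads_twist b b' :
  spreads (twist R (over_or_under b) (over_or_under b')) (spread_twist b b').
Proof.
split.
- move=> x colx.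
  have [||| xA1 xB1] := @coloring_crossing _ _ _ _ _ (@Ordinal 2 0 isT)
    (@Ordinal 2 1 isT) 0 0 b colx isT isT; [by solve_crossing..|].
  have [||| xB3 xA3] := @coloring_crossing _ _ _ _ _ (@Ordinal 2 1 isT)
    (@Ordinal 2 0 isT) 2 2 b' colx isT isT; [by solve_crossing..|].
  have xA2 : x (@Ordinal 2 0 isT) 2 = x (@Ordinal 2 0 isT) 1.
    by apply: (@coloring_simple _ _ _ _ _ _ 1 colx isT); eval_tangle.
  have xB2 : x (@Ordinal 2 1 isT) 2 = x (@Ordinal 2 1 isT) 1.
    by apply: (@coloring_simple _ _ _ _ _ _ 1 colx isT); eval_tangle.
  apply: ord2P; apply: lt4P; rewrite /spread_twist /=;
  by rewrite ?(xA3, xA2, xA1, xB3, xB2, xB1).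
- move=> a; apply: graph_coloring.
  + by apply: ord2P.
  + by apply: ord2P; apply: lt3P; eval_tangle; move: b b' => [] [].
  + by apply: lt3P; apply: ord2P; apply: ord2P; eval_tangle;
      move: b b' => [] [] //= _ _; rewrite /spread_twist /=; ring.
- by move=> a; apply: ord2P.
- by move=> a; apply: ord2P; apply: lt4P; rewrite /spread_twist /= ?after_crossing_const.
Qed.

(** The crossings are met in the order AC, AB, BC; the index of a color is the first piece that
    bears it. *)
Definition spread_below ab ac bc (a : 'I_3 -> K) (i : 'I_3) (k : nat) : K :=
  let a0 := a (@Ordinal 3 0 isT) in
  let b0 := a (@Ordinal 3 1 isT) in
  let c0 := a (@Ordinal 3 2 isT) in
  let a1 := AC ac a0 c0 in let c1 := AC (~~ ac) c0 a0 in
  let a2 := AC ab a1 b0 in let b2 := AC (~~ ab) b0 a1 in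
  let b3 := AC bc b2 c1 in let c3 := AC (~~ bc) c1 b2 in
  nth 0 (nth [::] [:: [:: a0; a1; a2; a2]; [:: b0; b0; b2; b3];
                      [:: c0; c1; c1; c3]] i) k.

Lemma spreads_below ab ac bc :
  spreads (triangle_below R (over_or_under ab) (over_or_under ac) (over_or_under bc))
    (spread_below ab ac bc).
Proof.
split.
- move=> x colx.
  have [||| xA1 xC1] := @coloring_crossing _ _ _ _ _ (@Ordinal 3 0 isT)
    (@Ordinal 3 2 isT) 0 0 ac colx isT isT; [by solve_crossing..|].
  have [||| xA2 xB2] := @coloring_crossing _ _ _ _ _ (@Ordinal 3 0 isT)
    (@Ordinal 3 1 isT) 1 1 ab colx isT isT; [by solve_crossing..|].
  have [||| xB3 xC3] := @coloring_crossing _ _ _ _ _ (@Ordinal 3 1 isT)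
    (@Ordinal 3 2 isT) 2 2 bc colx isT isT; [by solve_crossing..|].
  have xA3 : x (@Ordinal 3 0 isT) 3 = x (@Ordinal 3 0 isT) 2.
    by apply: (@coloring_simple _ _ _ _ _ _ 2 colx isT); eval_tangle.
  have xB1 : x (@Ordinal 3 1 isT) 1 = x (@Ordinal 3 1 isT) 0.
    by apply: (@coloring_simple _ _ _ _ _ _ 0 colx isT); eval_tangle.
  have xC2 : x (@Ordinal 3 2 isT) 2 = x (@Ordinal 3 2 isT) 1.
    by apply: (@coloring_simple _ _ _ _ _ _ 1 colx isT); eval_tangle.
  apply: ord3P; apply: lt4P; rewrite /spread_below /=;
  by rewrite ?(xA3, xA2, xA1, xB3, xB2, xB1, xC3, xC2, xC1).
- move=> a; apply: graph_coloring.
  + by apply: ord3P.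
  + by apply: ord3P; apply: lt3P; eval_tangle; move: ab ac bc => [] [] [].
  + by apply: lt3P; apply: ord3P; apply: ord3P; eval_tangle;
      move: ab ac bc => [] [] [] //= _ _; rewrite /spread_below /=; ring.
- by move=> a; apply: ord3P.
- move=> a; apply: ord3P; apply: lt4P; rewrite /spread_below /= ?after_crossing_const//.
Qed.

(** The order of the crossings is now BC, AB, AC. *)
Definition spread_above ab ac bc (a : 'I_3 -> K) (i : 'I_3) (k : nat) : K :=
  let a0 := a (@Ordinal 3 0 isT) in
  let b0 := a (@Ordinal 3 1 isT) in
  let c0 := a (@Ordinal 3 2 isT) in
  let b1 := AC bc b0 c0 in let c1 := AC (~~ bc) c0 b0 in
  let a2 := AC ab a0 b1 in let b2 := AC (~~ ab) b1 a0 in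
  let a3 := AC ac a2 c1 in let c3 := AC (~~ ac) c1 a2 in
  nth 0 (nth [::] [:: [:: a0; a0; a2; a3]; [:: b0; b1; b2; b2];
                      [:: c0; c1; c1; c3]] i) k.

Lemma spreads_above ab ac bc :
  spreads (triangle_above R (over_or_under ab) (over_or_under ac) (over_or_under bc))
    (spread_above ab ac bc).
Proof.
split.
- move=> x colx.
  have [||| xB1 xC1] := @coloring_crossing _ _ _ _ _ (@Ordinal 3 1 isT)
    (@Ordinal 3 2 isT) 0 0 bc colx isT isT; [by solve_crossing..|].
  have [||| xA2 xB2] := @coloring_crossing _ _ _ _ _ (@Ordinal 3 0 isT)
    (@Ordinal 3 1 isT) 1 1 ab colx isT isT; [by solve_crossing..|].
  have [||| xA3 xC3] := @coloring_crossing _ _ _ _ _ (@Ordinal 3 0 isT)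
    (@Ordinal 3 2 isT) 2 2 ac colx isT isT; [by solve_crossing..|].
  have xA1 : x (@Ordinal 3 0 isT) 1 = x (@Ordinal 3 0 isT) 0.
    by apply: (@coloring_simple _ _ _ _ _ _ 0 colx isT); eval_tangle.
  have xB3 : x (@Ordinal 3 1 isT) 3 = x (@Ordinal 3 1 isT) 2.
    by apply: (@coloring_simple _ _ _ _ _ _ 2 colx isT); eval_tangle.
  have xC2 : x (@Ordinal 3 2 isT) 2 = x (@Ordinal 3 2 isT) 1.
    by apply: (@coloring_simple _ _ _ _ _ _ 1 colx isT); eval_tangle.
  apply: ord3P; apply: lt4P; rewrite /spread_above /=;
  by rewrite ?(xA3, xA2, xA1, xB3, xB2, xB1, xC3, xC2, xC1).
- move=> a; apply: graph_coloring.
  + by apply: ord3P.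
  + by apply: ord3P; apply: lt3P; eval_tangle; move: ab ac bc => [] [] [].
  + by apply: lt3P; apply: ord3P; apply: ord3P; eval_tangle;
      move: ab ac bc => [] [] [] //= _ _; rewrite /spread_above /=; ring.
- by move=> a; apply: ord3P.
- by move=> a; apply: ord3P; apply: lt4P; rewrite /spread_above /= ?after_crossing_const.
Qed.

(** The upper strand keeps its color q, and the lower one is reflected twice: 2q - (2q - c) = c. *)
Lemma overlap_ends b a i : spread_constant a i 3 = spread_overlap b a i 3.
Proof.
by move: i; apply: ord2P; case: b;
  rewrite /spread_constant /spread_overlap /after_crossing /=; try ring.
Qed.

Lemma twist_ends b b' a i : spread_twist b b' a i 3 = spread_twist b' b a i 3.
Proof.
by move: i; apply: ord2P; case: b; case: b';
  rewrite /spread_twist /after_crossing /=; try ring.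
Qed.

(* The hypotheses exclude the two cyclic arrangements of the heights. *)
Lemma triangle_ends ab ac bc a i :
  ~~ [&& ab, bc & ~~ ac] -> ~~ [&& ~~ ab, ~~ bc & ac] ->
  spread_below ab ac bc a i 3 = spread_above ab ac bc a i 3.
Proof.
by move: i; apply: ord3P; case: ab; case: ac; case: bc => //= _ _;
  rewrite /spread_below /spread_above /after_crossing /=; try ring.
Qed.

End Moves.

(** * The tangles of the moves stay in the square and cross at the breaks *)

Section StandardTangles.
Variable R : realType.

Lemma sqr_itv (u : R) : `|u| <= 1 -> 0 <= u ^+ 2 <= 1.
Proof. by rewrite ler_norml => /andP[u0 u1]; nra. Qed.

Ltac find_break :=
  repeat case: eqP => [-> _|_];
  by [|exists 0%N; rewrite ?break0|exists 1%N; rewrite ?break1|exists 2%N; rewrite ?break2].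

Ltac check_square :=
  move=> /[dup] /sqr_itv /andP[? ?]; rewrite ler_norml => /andP[? ?];
  split; rewrite /tangle_path /tnth /= ler_norml; apply/andP; split; nra.

Lemma standard_segment : standard (segment R).
Proof. by split=> i u; rewrite (ord1 i); [check_square|]. Qed.

Lemma standard_kink x : standard (kink R x).
Proof.
split=> i u; rewrite (ord1 i) /tangle_pass /=; first by check_square.
by find_break.
Qed.

Lemma standard_parallel : standard (parallel R).
Proof. by split=> i u; move: i; apply: ord2P; try check_square. Qed.

Lemma standard_overlap x : standard (overlap R x).
Proof.
split=> i u; move: i; apply: ord2P; rewrite /tangle_pass /=;
  by [check_square|find_break].
Qed.

Lemma standard_twist x y : standard (twist R x y).
Proof.
split=> i u; move: i; apply: ord2P; rewrite /tangle_pass /=;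
  by [check_square|find_break].
Qed.

Lemma standard_below ab ac bc : standard (triangle_below R ab ac bc).
Proof.
split=> i u; move: i; apply: ord3P; rewrite /tangle_pass /=;
  by [check_square|find_break].
Qed.

Lemma standard_above ab ac bc : standard (triangle_above R ab ac bc).
Proof.
split=> i u; move: i; apply: ord3P; rewrite /tangle_pass /=;
  by [check_square|find_break].
Qed.

End StandardTangles.

(** * The precrossings of the tangles of the moves and their resolutions *)

Section ResolvingFamilies.
Variable R : realType.

Ltac never_pre :=
  rewrite /tangle_pass /=; repeat (case: eqP => _ //);
  by rewrite ?opp_over_or_under; exact: over_or_under_neq_Pre.

Lemma resolving_segment : resolving (fun=> segment R).
Proof. by apply: classical_resolving => i u; rewrite (ord1 i). Qed.

Lemma resolving_kink b : resolving (fun=> kink R (over_or_under b)).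
Proof. by apply: classical_resolving => i u; rewrite (ord1 i); never_pre. Qed.

Lemma resolving_parallel : resolving (fun=> parallel R).
Proof. by apply: classical_resolving => i u; move: i; apply: ord2P. Qed.

Lemma resolving_overlap b : resolving (fun=> overlap R (over_or_under b)).
Proof. by apply: classical_resolving => i u; move: i; apply: ord2P; never_pre. Qed.

Lemma resolving_below ab ac bc : resolving (fun=>
  triangle_below R (over_or_under ab) (over_or_under ac) (over_or_under bc)).
Proof. by apply: classical_resolving => i u; move: i; apply: ord3P; never_pre. Qed.

Lemma resolving_above ab ac bc : resolving (fun=>
  triangle_above R (over_or_under ab) (over_or_under ac) (over_or_under bc)).
Proof. by apply: classical_resolving => i u; move: i; apply: ord3P; never_pre. Qed.

Lemma normr_half : `|2^-1 : R| <= 1 /\ `|- 2^-1 : R| <= 1.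
Proof. by split; rewrite ler_norml; apply/andP; split; lra. Qed.

Ltac case_marks :=
  repeat (case: eqP => [|_];
          [let E := fresh in move=> E; rewrite ?E ?eqxx ?eq_breaks /=|]).

Ltac pass_formula := rewrite !xpair_eqE /tangle_pass /=; by case_marks.

Ltac pre_only :=
  rewrite /tangle_pass /=; case_marks; rewrite ?opp_over_or_under;
  by [left|right|move=> // /over_or_under_neq_Pre].

Lemma resolving_pre_kink : resolving (@kink R).
Proof.
have [H1 H2] := normr_half.
apply: (@precrossing_resolving _ _ _ (ord0, - 2^-1) (ord0, 2^-1)) => //=.
- by rewrite xpair_eqE eq_breaks andbF.
- by move=> x i; rewrite (ord1 i).
- by solve_crossing.
- by move=> x i u; rewrite (ord1 i); pass_formula.
- by move=> i u; rewrite (ord1 i); pre_only.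
Qed.

Lemma resolving_pre_twist b : resolving (fun x => twist R x (over_or_under b)).
Proof.
have [H1 H2] := normr_half.
apply: (@precrossing_resolving _ _ _ (@Ordinal 2 0 isT, - 2^-1)
  (@Ordinal 2 1 isT, - 2^-1)) => //=.
- by move=> x; apply: ord2P.
- by solve_crossing.
- by move=> x i u; move: i; apply: ord2P; pass_formula.
- by move=> i u; move: i; apply: ord2P; pre_only.
Qed.

Lemma resolving_twist_pre b : resolving (fun x => twist R (over_or_under b) x).
Proof.
have [H1 H2] := normr_half.
(* The last argument of [twist] is the passage of the second strand at 1/2, so that strand comes
   first. *)
apply: (@precrossing_resolving _ _ _ (@Ordinal 2 1 isT, 2^-1)
  (@Ordinal 2 0 isT, 2^-1)) => //=.
- by move=> x; apply: ord2P.
- by solve_crossing.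
- by move=> x i u; move: i; apply: ord2P; pass_formula.
- by move=> i u; move: i; apply: ord2P; pre_only.
Qed.

Lemma resolving_pre_below ac bc : resolving (fun x =>
  triangle_below R x (over_or_under ac) (over_or_under bc)).
Proof.
apply: (@precrossing_resolving _ _ _ (@Ordinal 3 0 isT, 0)
  (@Ordinal 3 1 isT, 0)); rewrite ?normr0 ?ler01 //=.
- by move=> x; apply: ord3P.
- by solve_crossing.
- by move=> x i u; move: i; apply: ord3P; pass_formula.
- by move=> i u; move: i; apply: ord3P; pre_only.
Qed.

Lemma resolving_pre_above ac bc : resolving (fun x =>
  triangle_above R x (over_or_under ac) (over_or_under bc)).
Proof.
apply: (@precrossing_resolving _ _ _ (@Ordinal 3 0 isT, 0)
  (@Ordinal 3 1 isT, 0)); rewrite ?normr0 ?ler01 //=.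
- by move=> x; apply: ord3P.
- by solve_crossing.
- by move=> x i u; move: i; apply: ord3P; pass_formula.
- by move=> i u; move: i; apply: ord3P; pre_only.
Qed.

End ResolvingFamilies.

(** * Equivalence of the two sides of every move, and invariance of colorability *)

Definition move_families (R : realType) (K : zmodType) n (T T' : n.-tuple (strand R)) :=
  exists F F', [/\ F Pre = T, F' Pre = T',
    equivalent_families K F F' & equivalent_families K F' F].

Lemma move_familiesI (R : realType) (K : comNzRingType) n
    (F F' : passage -> n.-tuple (strand R))
    (S S' : bool -> ('I_n -> K) -> 'I_n -> nat -> K) :
  resolving F -> resolving F' -> standard (F Pre) -> standard (F' Pre) ->
  (forall b, spreads (F (over_or_under b)) (S b)) ->
  (forall b, spreads (F' (over_or_under b)) (S' b)) ->
  (forall b a i, S b a i 3 = S' b a i 3) ->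
  move_families K (F Pre) (F' Pre).
Proof.
move=> rF rF' sF sF' FS F'S' SS'; exists F, F'; split=> //; split=> // b.
  exact: spreads_transfers (FS b) (F'S' b) (SS' b).
by apply: spreads_transfers (F'S' b) (FS b) _ => a i; rewrite SS'.
Qed.

(** Classical moves use constant families; in a pseudo-move the precrossing becomes the parameter,
    shared by the two sides. *)
Lemma local_move_families (R : realType) (K : comNzRingType) n
    (T T' : n.-tuple (strand R)) :
  local_move T T' -> move_families K T T'.
Proof.
case=> {n T T'}.
- move=> b; apply: (move_familiesI (resolving_segment R) (resolving_kink R b)
    (standard_segment R) (standard_kink R _)
    (fun=> spreads_segment R K) (fun=> spreads_kink R K b)).
  by [].
- move=> b; apply: (move_familiesI (resolving_parallel R) (resolving_overlap R b)
    (standard_parallel R) (standard_overlap R _)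
    (fun=> spreads_parallel R K) (fun=> spreads_overlap R K b)) => _.
  exact: overlap_ends.
- move=> ha hb hc huniq ab ac bc; rewrite /ab /ac /bc.
  apply: (move_familiesI (resolving_below R _ _ _) (resolving_above R _ _ _)
    (standard_below R _ _ _) (standard_above R _ _ _)
    (fun=> spreads_below R K _ _ _) (fun=> spreads_above R K _ _ _)) => _ a i.
  move: huniq; rewrite /= !inE negb_or => /and3P[/andP[? ?] ? _].
  (* Numerical heights cannot be arranged cyclically. *)
  by apply: triangle_ends; apply/negP => /and3P[]; lia.
- apply: (move_familiesI (resolving_segment R) (resolving_pre_kink R)
    (standard_segment R) (standard_kink R _)
    (fun=> spreads_segment R K) (spreads_kink R K)).
  by [].
- move=> b; apply: (move_familiesI (resolving_pre_twist R b) (resolving_twist_pre R b)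
    (standard_twist R _ _) (standard_twist R _ _)
    (fun b' => spreads_twist R K b' b) (fun b' => spreads_twist R K b b')) => b'.
  exact: twist_ends.
- apply: (move_familiesI (resolving_pre_below R true true) (resolving_pre_above R true true)
    (standard_below R _ _ _) (standard_above R _ _ _)
    (fun b => spreads_below R K b true true) (fun b => spreads_above R K b true true)) => b a i.
  (* The strand [C] lies under both others, so neither resolution of their crossing makes the
     arrangement cyclic. *)
  by apply: triangle_ends; case: b.
- apply: (move_familiesI (resolving_pre_below R false false) (resolving_pre_above R false false)
    (standard_below R _ _ _) (standard_above R _ _ _)
    (fun b => spreads_below R K b false false) (fun b => spreads_above R K b false false)) => b a i.
  by apply: triangle_ends; case: b.
Qed.

Theorem theorem2 (R : realType) (p : nat) (hp : (2 <= p)%N)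
    (P P' : pseudodiagram R) (hPP' : same_pseudoknot P P') :
  colorable p P <-> colorable p P'.
Proof.
elim: hPP' => {P P'} [P P' [PP'|[n [T [T' [TT' PP']]]]]|//|P P' _|P P' P'' _ + _].
- have {}PP' := planar_isotopic_reparametrized PP'.
  by split; apply: reparametrized_colorable => //; exact: reparametrized_sym.
- have [F [F' [FT FT' FF' F'F]]] := local_move_families 'Z_p TT'.
  rewrite -FT -FT' in PP'.
  split; first exact: equivalent_families_colorable FF' (local_replacement_sym PP').
  exact: equivalent_families_colorable F'F PP'.
- by move=> ->.
- by move=> -> ->.
Qed.
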